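(* For every rich computable Polish space $\mathcal{X}$, $\mathsf{PK}_{\mathcal{X}}\equiv_{\mathrm{W}}\mathsf{PK}_{\mathbb{N}^{\mathbb{N}}}$.
   Context: A represented space is a set $X$ with a partial surjection $\delta_X:\subseteq\mathbb{N}^{\mathbb{N}}\to X$; $p$ is a name of $x$ if $\delta_X(p)=x$. A (multi-valued) function between represented spaces is computable if there is a computable partial map on $\mathbb{N}^{\mathbb{N}}$ sending each name of a point of the domain to a name of a value. A problem is a partial multi-valued function $f:\subseteq X\rightrightarrows Y$ between represented spaces. $f\le_{\mathrm{W}} g$ (Weihrauch reducibility) means that there are computable partial maps $\Phi,\Psi:\subseteq\mathbb{N}^{\mathbb{N}}\to\mathbb{N}^{\mathbb{N}}$ such that for every name $p$ of some $x\in\mathrm{dom}(f)$, $\Phi(p)$ is a name of some $y\in\mathrm{dom}(g)$, and for every name $q$ of an element of $g(y)$, $\Psi(p*q)$ is a name of an element of $f(x)$, where $p*q$ is the interleaving of $p$ and $q$. $f\equiv_{\mathrm{W}}g$ means reducibility both ways. A computable metric space $\mathcal{X}=(X,d,\alpha)$ is a separable metric space with a dense sequence $\alpha:\mathbb{N}\to X$ such that $(i,j)\mapsto d(\alpha(i),\alpha(j))$ is a computable double sequence of reals. It is represented by the Cauchy representation: $p$ is a name of $\lim_n\alpha(p(n))$ whenever $d(\alpha(p(i)),\alpha(p(j)))<2^{-j}$ for all $i>j$ and the limit exists in $X$. It is a computable Polish space if $d$ is complete. $(q_m)$ is a fixed computable enumeration of $\mathbb{Q}$ and $B_{\langle n,m\rangle}=\{x:d(x,\alpha(n))<q_m\}$.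 $\mathcal{A}(\mathcal{X})$ is the space of closed subsets of $X$ with the negative representation: $p$ is a name of $X\setminus\bigcup_iB_{p(i)}$. For Baire space this is equivalent to naming $C$ by a tree $T\subseteq\mathbb{N}^{<\mathbb{N}}$ whose set of infinite paths is $C$. A computable metric space $\mathcal{X}$ is rich if there is a computable injective map $\iota:2^{\mathbb{N}}\to\mathcal{X}$ whose partial inverse is also computable. A closed set is perfect if it has no isolated points; the perfect kernel of a closed set $A$ in a Polish space is the unique perfect $P\subseteq A$ with $A\setminus P$ countable. $\mathsf{PK}_{\mathcal{X}}:\mathcal{A}(\mathcal{X})\to\mathcal{A}(\mathcal{X})$ maps a closed set to its perfect kernel. *)

(* Defs.v *)
From HB Require Import structures.
From Stdlib Require Import Cantor.
From mathcomp Require Import all_boot all_order all_algebra.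
From mathcomp Require Import all_classical all_reals topology.

Set Implicit Arguments.
Unset Strict Implicit.
Unset Printing Implicit Defensive.

Import Order.TTheory GRing.Theory Num.Theory.

Local Open Scope classical_set_scope.
Local Open Scope ring_scope.

Definition baire : Type := nat -> nat.

Definition cpair (x y : nat) : nat := Cantor.to_nat (x, y).
Definition cfst (n : nat) : nat := (Cantor.of_nat n).1.
Definition csnd (n : nat) : nat := (Cantor.of_nat n).2.

(** Kleene's partial recursive functions relative to an oracle [p : baire];
    all functions are unary, tuples being coded with [cpair]. *)
Inductive code : Type :=
  | CZero | CSucc | CFst | CSnd | COracle
  | CPair of code & code
  | CComp of code & code
  | CRec of code & code
  | CMu of code.

(** [eval p e n m]: program [e] with oracle [p] halts on [n] with output [m].
    [CRec a b] sends [<x, 0>] to [a x] and [<x, k.+1>] to [b <x, <k, r>>] where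
    [r] is the value at [<x, k>]; [CMu a] sends [n] to the least [m] such that
    [a <n, m> = 0], all the values [a <n, j>] for [j < m] being defined. *)
Fixpoint eval (p : baire) (e : code) (n m : nat) {struct e} : Prop :=
  match e with
  | CZero => m = 0%N
  | CSucc => m = n.+1
  | CFst => m = cfst n
  | CSnd => m = csnd n
  | COracle => m = p n
  | CPair a b => exists x y, [/\ eval p a n x, eval p b n y & m = cpair x y]
  | CComp a b => exists x, eval p b n x /\ eval p a x m
  | CRec a b =>
      (fix it (k r : nat) {struct k} : Prop :=
         match k with
         | 0%N => eval p a (cfst n) r
         | k'.+1 => exists s, it k' s /\ eval p b (cpair (cfst n) (cpair k' s)) r
         end) (csnd n) m
  | CMu a => eval p a (cpair n m) 0%N /\
      forall j, (j < m)%N -> exists y, eval p a (cpair n j) y.+1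
  end.

(** [computes e p q]: the computable partial map on Baire space given by [e]
    is defined at [p] and has value [q] there. *)
Definition computes (e : code) (p q : baire) : Prop :=
  forall n, eval p e n (q n).

Lemma eval_functional p e n m1 m2 : eval p e n m1 -> eval p e n m2 -> m1 = m2.
Proof.
elim: e n m1 m2 => [||||| a IHa b IHb|a IHa b IHb|a IHa b IHb|a IHa] n m1 m2 /=;
  try by move=> -> ->.
- move=> [x [y [ax bx ->]]] [x' [y' [ax' bx' ->]]].
  by rewrite (IHa _ _ _ ax ax') (IHb _ _ _ bx bx').
- move=> [x [bx ax]] [x' [bx' ax']].
  by move: ax; rewrite (IHb _ _ _ bx bx') => ax; exact: IHa ax ax'.
- elim: (csnd n) m1 m2 => [|k IHk] m1 m2; first exact: IHa.
  move=> [s [sk bs]] [s' [sk' bs']].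
  by move: bs; rewrite (IHk _ _ sk sk') => bs; exact: IHb bs bs'.
- move=> [a1 h1] [a2 h2]; case: (ltngtP m1 m2) => // lt.
  + by have [y ay] := h2 _ lt; have := IHa _ _ _ ay a1.
  + by have [y ay] := h1 _ lt; have := IHa _ _ _ ay a2.
Qed.

Lemma computes_functional e p q1 q2 :
  computes e p q1 -> computes e p q2 -> q1 = q2.
Proof. by move=> h1 h2; apply/funext => n; exact: eval_functional (h1 n) (h2 n). Qed.

Definition computable_nat (f : nat -> nat) : Prop :=
  exists e, computes e (fun=> 0%N) f.

Definition interleave (p q : baire) : baire :=
  fun n => if odd n then q n./2 else p n./2.

(** The representation, a partial surjection from Baire space, is given by its
    graph: [is_name p x] means that [p] is a name of [x]. *)
Record repSpace : Type := RepSpace {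
  rep_sort :> Type;
  is_name : baire -> rep_sort -> Prop;
  is_name_functional : forall p x y, is_name p x -> is_name p y -> x = y;
  is_name_surjective : forall x, exists p, is_name p x
}.

(** A partial multi-valued function; [x] is in its domain iff [f x !=set0]. *)
Definition problem (X Y : repSpace) : Type := X -> set Y.

Definition computable_problem (X Y : repSpace) (f : problem X Y) : Prop :=
  exists e : code, forall (x : X) (p : baire), f x !=set0 -> is_name p x ->
    exists (q : baire) (y : Y), [/\ computes e p q, is_name q y & f x y].

Definition weihrauch_le (X Y Z W : repSpace)
    (f : problem X Y) (g : problem Z W) : Prop :=
  exists phi psi : code,
    forall (x : X) (p : baire), f x !=set0 -> is_name p x ->
      exists (p' : baire) (z : Z),
        [/\ computes phi p p', is_name p' z, g z !=set0 &
          forall (w : W) (q : baire), g z w -> is_name q w ->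
            exists (q' : baire) (y : Y),
              [/\ computes psi (interleave p q) q', is_name q' y & f x y]].

Definition weihrauch_equiv (X Y Z W : repSpace)
    (f : problem X Y) (g : problem Z W) : Prop :=
  weihrauch_le f g /\ weihrauch_le g f.

Definition cantor_name (p : baire) (x : nat -> bool) : Prop :=
  p = (fun n => nat_of_bool (x n)).

Lemma cantor_name_functional p x y :
  cantor_name p x -> cantor_name p y -> x = y.
Proof.
move=> -> e; apply/funext => n; have := congr1 (fun f : baire => f n) e.
by case: (x n) (y n) => [] [].
Qed.

Lemma cantor_name_surjective x : exists p, cantor_name p x.
Proof. by eexists. Qed.

Definition cantor_rep : repSpace :=
  RepSpace cantor_name_functional cantor_name_surjective.

Definition rat_enum (m : nat) : rat :=
  let: (ab, c) := Cantor.of_nat m in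
  let: (a, b) := Cantor.of_nat ab in
  (a%:R - b%:R) / c.+1%:R.

Definition computable_double_seq (R : realType) (x : nat -> nat -> R) : Prop :=
  exists a : nat -> nat, computable_nat a /\
    forall i j k,
      `| x i j - ratr (rat_enum (a (cpair (cpair i j) k))) | <= 2 ^- k.

Record computableMetricSpace (R : realType) : Type := ComputableMetricSpace {
  cms_sort :> metricType R;
  cms_seq : nat -> cms_sort;
  cms_dense : dense (range cms_seq);
  cms_computable :
    computable_double_seq (fun i j => mdist (cms_seq i) (cms_seq j))
}.

Definition computable_polish (R : realType) (X : computableMetricSpace R) : Prop :=
  forall u : nat -> X, cauchy (u @ \oo) -> exists x : X, u @ \oo --> x.

Definition basic_ball (R : realType) (X : computableMetricSpace R) (i : nat) :
    set X :=
  let: (n, m) := Cantor.of_nat i in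
  [set x | mdist x (cms_seq X n) < ratr (rat_enum m)].
Arguments basic_ball {R} X i.

Lemma pow2V_lt (R : realType) (e : R) : 0 < e -> exists k, 2 ^- k < e.
Proof.
move=> e0; exists (Num.bound e^-1).
rewrite invf_plt ?posrE ?exprn_gt0 //; apply: upper_nthrootP.
exact: leqnn.
Qed.

Lemma rat_enum_surj (q : rat) : exists m, rat_enum m = q.
Proof.
pose a := if 0 <= numq q then `|numq q|%N else 0%N.
pose b := if 0 <= numq q then 0%N else `|numq q|%N.
exists (cpair (cpair a b) `|denq q|.-1).
rewrite /rat_enum /cpair !Cantor.cancel_of_to prednK ?absz_gt0 ?denq_neq0 //.
have -> : a%:R - b%:R = (numq q)%:~R :> rat.
  rewrite /a /b; case: (lerP 0 (numq q)) => h.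
    by rewrite subr0 pmulrn gez0_abs.
  by rewrite sub0r pmulrn ltz0_abs // mulrNz opprK.
by rewrite pmulrn absz_denq divq_num_den.
Qed.

Section CauchyRep.
Variables (R : realType) (X : computableMetricSpace R).

Definition cauchy_name (p : baire) (x : X) : Prop :=
  (forall i j, (j < i)%N ->
     mdist (cms_seq X (p i)) (cms_seq X (p j)) < 2 ^- j) /\
  (fun n => cms_seq X (p n)) @ \oo --> x.

Lemma cauchy_name_functional p x y :
  cauchy_name p x -> cauchy_name p y -> x = y.
Proof.
by move=> [_ px] [_ py]; exact: (cvg_unique (@metric_hausdorff R X) px py).
Qed.

Lemma cauchy_name_surjective x : exists p, cauchy_name p x.
Proof.
have e0 n : 0 < 2 ^- n :> R by rewrite invr_gt0 exprn_gt0.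
have near_x n : exists i, mdist x (cms_seq X i) < 2 ^- n.+1.
  have [|y [xy [i _ iy]]] := cms_dense _ (open_interior (ball x (2 ^- n.+1))).
    exact: (ex_intro _ x (nbhsx_ballx x _ (e0 _))).
  by exists i; have := interior_subset xy; rewrite ballEmdist /= -iy.
have [p pP] := choice near_x; exists p; split.
  move=> i j ji; apply: le_lt_trans (metric_triangle _ x _) _.
  rewrite metric_sym; apply: lt_le_trans (ltrD (pP i) (pP j)) _.
  rewrite [leRHS](_ : _ = 2 ^- j.+1 + 2 ^- j.+1).
    by rewrite lerD2r lef_pV2 ?posrE ?exprn_gt0 // ler_eXn2l ?ltr1n // ltnW.
  by rewrite exprS invfM mulrC -splitr.
apply/metricType_numDomainType.cvgrPdist_lt => e egt0.
have [k ke] := pow2V_lt egt0.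
exists k => // n /= kn; apply: lt_trans (pP n) _; apply: le_lt_trans ke.
by rewrite lef_pV2 ?posrE ?exprn_gt0 // ler_eXn2l ?ltr1n // ltnW.
Qed.

Definition cauchy_rep : repSpace :=
  RepSpace cauchy_name_functional cauchy_name_surjective.

End CauchyRep.

Section NegativeRep.
Variables (R : realType) (X : computableMetricSpace R).

Definition closed_subset : Type := {A : set X | closed A}.

Definition negative_name (p : baire) (A : closed_subset) : Prop :=
  sval A = ~` \bigcup_i basic_ball X (p i).

Lemma negative_name_functional p A B :
  negative_name p A -> negative_name p B -> A = B.
Proof.
move=> pA pB; have : sval A = sval B by rewrite pA pB.
case: A B {pA pB} => [A cA] [B cB] /= AB; case: _ / AB cB => cB.
by congr exist; exact: Prop_irrelevance.
Qed.

Lemma negative_name_surjective A : exists p, negative_name p A.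
Proof.
case: A => A clA; pose U := ~` A; have opU : open U by exact: closed_openC.
pose p i := if `[< basic_ball X i `<=` U >] then i else 0%N.
exists p; rewrite /negative_name /=; apply: setC_inj; rewrite setCK.
apply/seteqP; split => [x Ux|x [i _]]; last first.
  rewrite /p; case: asboolP => [sub xi|_]; first exact: sub xi.
  rewrite /basic_ball /= /rat_enum /= subrr mul0r rmorph0.
  by rewrite ltNge mdist_ge0.
have /nbhs_ballP [e /= e0 eU] := open_nbhs_nbhs (conj opU Ux).
have e20 : 0 < e / 2 by rewrite divr_gt0.
have [|y [xy [n _ ny]]] := cms_dense _ (open_interior (ball x (e / 2))).
  exact: (ex_intro _ x (nbhsx_ballx x _ e20)).
have xn : mdist x (cms_seq X n) < e / 2.
  by have := interior_subset xy; rewrite ballEmdist /= -ny.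
have /rat_in_itvoo [q] := xn; rewrite in_itv /= => /andP[xq qe].
have [m mq] := rat_enum_surj q.
exists (cpair n m) => //; rewrite /p; case: asboolP => [_|].
  by rewrite /basic_ball /cpair Cantor.cancel_of_to /= mq.
case; rewrite /basic_ball /cpair Cantor.cancel_of_to mq => z /= zq.
apply: eU; rewrite ballEmdist /=.
apply: le_lt_trans (metric_triangle _ (cms_seq X n) _) _.
by rewrite [ltRHS]splitr ltrD // metric_sym (lt_trans zq).
Qed.

Definition negative_rep : repSpace :=
  RepSpace negative_name_functional negative_name_surjective.

End NegativeRep.

Definition rich (R : realType) (X : computableMetricSpace R) : Prop :=
  exists iota : (nat -> bool) -> X,
    [/\ injective iota,
        @computable_problem cantor_rep (cauchy_rep X) (fun u => [set iota u]) &
        @computable_problem (cauchy_rep X) cantor_rep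
          (fun x => [set u | iota u = x])].

Definition perfect_kernel (T : topologicalType) (A P : set T) : Prop :=
  [/\ perfect_set P, P `<=` A & countable (A `\` P)].

(** By the Cantor-Bendixson theorem this problem is total and single-valued
    when [X] is Polish. *)
Definition PK (R : realType) (X : computableMetricSpace R) :
    problem (negative_rep X) (negative_rep X) :=
  fun A => [set P | perfect_kernel (sval A) (sval P)].
Arguments PK {R} X A.

Section PrimRec.
Local Open Scope nat_scope.

(** Functions computed by one and the same program for all oracles. *)
Definition tot (f : nat -> nat) : Prop :=
  exists e, forall p n, eval p e n (f n).

Lemma tot_computable f : tot f -> computable_nat f.
Proof. by move=> [e eP]; exists e => n; exact: eP. Qed.

Lemma tot_comp f g : tot f -> tot g -> tot (fun n => f (g n)).
Proof. by move=> [a aP] [b bP]; exists (CComp a b) => p n /=; exists (g n). Qed.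

Lemma tot_pair f g : tot f -> tot g -> tot (fun n => cpair (f n) (g n)).
Proof.
by move=> [a aP] [b bP]; exists (CPair a b) => p n /=; exists (f n), (g n).
Qed.

Lemma tot_fst f : tot f -> tot (fun n => cfst (f n)).
Proof. by apply: tot_comp; exists CFst. Qed.

Lemma tot_snd f : tot f -> tot (fun n => csnd (f n)).
Proof. by apply: tot_comp; exists CSnd. Qed.

Lemma tot_succ f : tot f -> tot (fun n => (f n).+1).
Proof. by apply: tot_comp; exists CSucc. Qed.

Lemma tot_const k : tot (fun=> k).
Proof. by elim: k => [|k]; [exists CZero | exact: tot_succ]. Qed.

Lemma cpairK x y : Cantor.of_nat (cpair x y) = (x, y).
Proof. exact: Cantor.cancel_of_to. Qed.

Lemma cfst_pair x y : cfst (cpair x y) = x.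
Proof. by rewrite /cfst cpairK. Qed.

Lemma csnd_pair x y : csnd (cpair x y) = y.
Proof. by rewrite /csnd cpairK. Qed.

Lemma cpair_fst_snd n : cpair (cfst n) (csnd n) = n.
Proof.
by rewrite /cpair -[RHS]Cantor.cancel_to_of /cfst /csnd; case: Cantor.of_nat.
Qed.

Lemma tot_id : tot id.
Proof.
exists (CPair CFst CSnd) => p n /=; exists (cfst n), (csnd n).
by rewrite cpair_fst_snd.
Qed.

Fixpoint prec (a : nat) (b : nat -> nat -> nat) (k : nat) : nat :=
  if k is k'.+1 then b k' (prec a b k') else a.

(** The step function reads its context, counter and previous value from a
    coded triple. *)
Lemma tot_prec (a k : nat -> nat) (b : nat -> nat -> nat -> nat) :
  tot a -> tot k ->
  tot (fun t => b (cfst t) (cfst (csnd t)) (csnd (csnd t))) ->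
  tot (fun n => prec (a n) (b n) (k n)).
Proof.
move=> [ea aP] [ek kP] [eb bP].
have [ei iP] := tot_id.
exists (CComp (CRec ea eb) (CPair ei ek)) => p n.
exists (cpair n (k n)); split; first by exists n, (k n).
rewrite /= csnd_pair cfst_pair; elim: (k n) => [|i IH] /=; first exact: aP.
exists (prec (a n) (b n) i); split => //.
by have := bP p (cpair n (cpair i (prec (a n) (b n) i)));
   rewrite !(cfst_pair, csnd_pair).
Qed.

Lemma tot_ext f g : f =1 g -> tot f -> tot g.
Proof. by move=> fg [e eP]; exists e => p n; rewrite -fg. Qed.

Lemma tot_ctx (f : nat -> nat) : tot f -> tot (fun t => f (cfst t)).
Proof. by move=> tf; apply: tot_comp => //; exact/tot_fst/tot_id. Qed.

Lemma tot_add f g : tot f -> tot g -> tot (fun n => f n + g n).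
Proof.
move=> tf tg; apply: (@tot_ext (fun n => prec (f n) (fun _ r => r.+1) (g n))).
  by move=> n; elim: (g n) => [|k /= ->]; rewrite ?addn0 ?addnS.
by apply: (tot_prec (b := fun _ _ r => r.+1)) => //; do !apply: tot_succ;
  do !apply: tot_snd; exact: tot_id.
Qed.

Lemma tot_pred f : tot f -> tot (fun n => (f n).-1).
Proof.
move=> tf; apply: (@tot_ext (fun n => prec 0 (fun k _ => k) (f n))).
  by move=> n; case: (f n).
apply: (tot_prec (b := fun _ k _ => k)) => //; first exact: tot_const.
by apply: tot_fst; apply: tot_snd; exact: tot_id.
Qed.

Lemma tot_sub f g : tot f -> tot g -> tot (fun n => f n - g n).
Proof.
move=> tf tg; apply: (@tot_ext (fun n => prec (f n) (fun _ r => r.-1) (g n))).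
  by move=> n; elim: (g n) => [|k /= ->]; rewrite ?subn0 ?subnS.
by apply: (tot_prec (b := fun _ _ r => r.-1)) => //; apply: tot_pred;
  do !apply: tot_snd; exact: tot_id.
Qed.

Lemma tot_exp2 f : tot f -> tot (fun n => 2 ^ f n).
Proof.
move=> tf; apply: (@tot_ext (fun n => prec 1 (fun _ r => r + r) (f n))).
  by move=> n; elim: (f n) => [|k /= ->]; rewrite // expnS mul2n addnn.
apply: (tot_prec (b := fun _ _ r => r + r)) => //; first exact: tot_const.
by apply: tot_add; do !apply: tot_snd; exact: tot_id.
Qed.

Lemma tot_if0 c f g : tot c -> tot f -> tot g ->
  tot (fun n => if c n == 0 then f n else g n).
Proof.
move=> tc tf tg.
apply: (@tot_ext (fun n => prec (f n) (fun _ _ => g n) (c n))).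
  by move=> n; case: (c n).
by apply: (tot_prec (b := fun n _ _ => g n)) => //; exact: tot_ctx.
Qed.

Lemma tot_ifeq a b f g : tot a -> tot b -> tot f -> tot g ->
  tot (fun n => if a n == b n then f n else g n).
Proof.
move=> ta tb tf tg.
apply: (@tot_ext
  (fun n => if (a n - b n) + (b n - a n) == 0 then f n else g n)).
  by move=> n; rewrite addn_eq0 !subn_eq0 -eqn_leq.
by apply: tot_if0 => //; apply: tot_add; apply: tot_sub.
Qed.

(** The [i]-th eventually zero sequence: [i] codes the iterated pair
    [<x0, <x1, <x2, ...>>>], the numbers [0] and [<0, 0>] being equal. *)
Definition baire_seq (i n : nat) : nat := cfst (iter n csnd i).

Lemma tot_baire_seq f g : tot f -> tot g -> tot (fun n => baire_seq (f n) (g n)).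
Proof.
move=> tf tg; apply: tot_fst.
apply: (@tot_ext (fun n => prec (f n) (fun _ r => csnd r) (g n))).
  by move=> n; elim: (g n) => //= k ->.
by apply: (tot_prec (b := fun _ _ r => csnd r)) => //;
  do !apply: tot_snd; exact: tot_id.
Qed.

Definition first_diff (x y : nat -> nat) (k : nat) : nat :=
  prec 0 (fun i r => if x r == y r then r.+1 else r) k.

Lemma first_diffP x y k : [/\ first_diff x y k <= k,
  (forall j, j < first_diff x y k -> x j = y j) &
  first_diff x y k < k -> x (first_diff x y k) <> y (first_diff x y k)].
Proof.
elim: k => [|k [le eqs ne]] //.
rewrite /first_diff /=; rewrite -/(first_diff x y k).
case: eqP => [e|n]; last by split => //; exact: leq_trans le _.
split=> // [j|lt]; first by rewrite ltnS leq_eqVlt => /orP[/eqP->|/eqs].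
by have := ne lt.
Qed.

Lemma tot_first_diff i j k : tot i -> tot j -> tot k ->
  tot (fun n => first_diff (baire_seq (i n)) (baire_seq (j n)) (k n)).
Proof.
move=> ti tj tk; apply: (tot_prec (b := fun n _ r =>
  if baire_seq (i n) r == baire_seq (j n) r then r.+1 else r)) => //.
  exact: tot_const.
have tr : tot (fun t => csnd (csnd t)) by do !apply: tot_snd; exact: tot_id.
apply: tot_ifeq => //; last exact: tot_succ.
- by apply: tot_baire_seq => //; exact: tot_ctx.
- by apply: tot_baire_seq => //; exact: tot_ctx.
Qed.

End PrimRec.

Definition baire_space (R : realType) : Type := nat -> nat.

HB.instance Definition _ (R : realType) :=
  Choice.copy (baire_space R) (nat -> nat).

Section BaireMetric.
Variable R : realType.
Implicit Types p q r : baire_space R.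

Definition baire_dist p q : R :=
  match pselect (exists n, p n != q n) with
  | left h => 2 ^- ex_minn h
  | right _ => 0
  end.

Lemma pow2V_gt0 n : 0 < 2 ^- n :> R.
Proof. by rewrite invr_gt0 exprn_gt0. Qed.

Lemma pow2V_le m n : (2 ^- m <= 2 ^- n :> R) = (n <= m)%N.
Proof. by rewrite lef_pV2 ?posrE ?exprn_gt0 // ler_eXn2l // ltr1n. Qed.

Lemma baire_dist_le p q n :
  baire_dist p q <= 2 ^- n <-> forall k, (k < n)%N -> p k = q k.
Proof.
rewrite /baire_dist; case: pselect => [h|h]; last first.
  split=> [_ k _|_]; last exact/ltW/pow2V_gt0.
  by apply: contra_notP h => /eqP ?; exists k.
case: ex_minnP => m /eqP dm mmin; rewrite pow2V_le; split=> [nm k kn|eqs].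
  by apply/eqP; apply: contraTT kn => /mmin /(leq_trans nm); rewrite -leqNgt.
by rewrite leqNgt; apply/negP => /eqs.
Qed.

Lemma baire_dist_ge p q n : p n <> q n -> 2 ^- n <= baire_dist p q.
Proof.
move=> /eqP pq; rewrite /baire_dist; case: pselect => [h|]; last first.
  by case; exists n.
by case: ex_minnP => m _ mmin; rewrite pow2V_le mmin.
Qed.

Lemma baire_dist_eq p q n : (forall k, (k < n)%N -> p k = q k) ->
  p n <> q n -> baire_dist p q = 2 ^- n.
Proof.
move=> eqs ne; apply/eqP; rewrite eq_le baire_dist_ge // andbT.
exact/baire_dist_le.
Qed.

Lemma baire_distP p q :
  (p = q /\ baire_dist p q = 0) \/
  exists2 n, p n <> q n & baire_dist p q = 2 ^- n.
Proof.
rewrite /baire_dist; case: pselect => [h|h]; [right|left].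
  by case: ex_minnP => m /eqP ? _; exists m.
by split => //; apply/funext => k; apply: contra_notP h => /eqP ?; exists k.
Qed.

Lemma baire_dist_ge0 p q : 0 <= baire_dist p q.
Proof. by have [[_ ->]|[n _ ->]] := baire_distP p q; last exact/ltW/pow2V_gt0. Qed.

Lemma baire_distxx p : baire_dist p p = 0.
Proof. by have [[]|[]] := baire_distP p p. Qed.

Lemma baire_dist_positivity p q : baire_dist p q = 0 -> p = q.
Proof.
have [[]//|[n _ ->] /eqP] := baire_distP p q.
by rewrite (negbTE (lt0r_neq0 (pow2V_gt0 n))).
Qed.

Lemma baire_dist_sym p q : baire_dist p q = baire_dist q p.
Proof.
wlog suff le : p q / baire_dist p q <= baire_dist q p.
  by apply/eqP; rewrite eq_le !le.
have [[_ ->]|[n ne ->]] := baire_distP p q; first exact: baire_dist_ge0.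
by apply: baire_dist_ge; exact: nesym.
Qed.

Lemma baire_dist_triangle q p r :
  baire_dist p r <= baire_dist p q + baire_dist q r.
Proof.
have [[_ ->]|[n ne ->]] := baire_distP p r.
  by rewrite addr_ge0 // baire_dist_ge0.
have [pq|/eqP pq] := eqVneq (p n) (q n).
  by rewrite ler_wpDl ?baire_dist_ge0 // baire_dist_ge // -pq.
by rewrite ler_wpDr ?baire_dist_ge0 // baire_dist_ge.
Qed.

End BaireMetric.

HB.instance Definition _ (R : realType) :=
  isMetric.Build R (baire_space R) (@baire_distxx R) (@baire_dist_positivity R)
    (@baire_dist_sym R) (@baire_dist_triangle R).

Section BaireComputable.
Variable R : realType.

Definition baire_alpha (i : nat) : baire_space R := baire_seq i.

Lemma baire_alpha_prefix (p : nat -> nat) n :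
  exists i, forall k, (k < n)%N -> baire_seq i k = p k.
Proof.
elim: n p => [|n IH] p; first by exists 0%N.
have [i iP] := IH (fun k => p k.+1).
exists (cpair (p 0%N) i) => -[_|k kn]; first by rewrite /baire_seq cfst_pair.
by rewrite /baire_seq iterSr csnd_pair; exact: iP.
Qed.

Lemma baire_alpha_dense : dense (range baire_alpha).
Proof.
move=> O [x Ox] opO.
have /nbhs_ballP [e /= e0 eO] := open_nbhs_nbhs (conj opO Ox).
have [n ne] := pow2V_lt e0; have [i iP] := baire_alpha_prefix x n.
exists (baire_alpha i); split; last by exists i.
apply: eO; rewrite ballEmdist /=; apply: le_lt_trans ne.
by apply/baire_dist_le => k kn; rewrite /baire_alpha iP.
Qed.

Lemma baire_alpha_computable :
  computable_double_seq (fun i j => mdist (baire_alpha i) (baire_alpha j)).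
Proof.
pose d i j k := first_diff (baire_seq i) (baire_seq j) k.
exists (fun t => cpair (cpair 1 0)
  (2 ^ d (cfst (cfst t)) (csnd (cfst t)) (csnd t)).-1)%N; split.
  apply/tot_computable/tot_pair; first by apply: tot_pair; exact: tot_const.
  apply/tot_pred/tot_exp2/tot_first_diff; last exact/tot_snd/tot_id.
  - exact/tot_fst/tot_fst/tot_id.
  - exact/tot_snd/tot_fst/tot_id.
move=> i j k; rewrite !(cfst_pair, csnd_pair) /rat_enum !cpairK.
rewrite prednK ?expn_gt0 // subr0 mul1r natrX fmorphV rmorphXn /= ratr_nat.
have [le eqs ne] := first_diffP (baire_seq i) (baire_seq j) k.
rewrite -/(d i j k) in le eqs ne *.
have [lt|] := ltnP (d i j k) k.
  rewrite [mdist _ _](_ : _ = 2 ^- d i j k); last first.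
    by apply: baire_dist_eq => //; exact: ne.
  by rewrite subrr normr0 ltW ?pow2V_gt0.
move=> ge; have {le ge} dk : d i j k = k by apply/eqP; rewrite eqn_leq le.
rewrite dk in eqs *; have /baire_dist_le le : forall l, (l < k)%N ->
  baire_alpha i l = baire_alpha j l by [].
rewrite ler0_norm ?subr_le0 // opprB lerBlDr lerDl.
exact: baire_dist_ge0.
Qed.

Definition baire_cms : computableMetricSpace R :=
  ComputableMetricSpace baire_alpha_dense baire_alpha_computable.

Lemma baire_polish : computable_polish baire_cms.
Proof.
move=> u /cauchy_ballP cu.
have agree n : exists N, forall i j, (N <= i)%N -> (N <= j)%N ->
    forall k, (k < n)%N -> (u i : nat -> nat) k = (u j : nat -> nat) k.
  have [[A B] /= [[N1 _ AN] [N2 _ BN]] AB] := cu _ (pow2V_gt0 R n).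
  exists (maxn N1 N2) => i j; rewrite !geq_max => /andP[i1 i2] /andP[j1 j2].
  have ij : mdist (u i) (u j) < 2 ^- n.
    by have := AB (u i, u j) (conj (AN i i1) (BN j j2)); rewrite /= ballEmdist.
  exact/baire_dist_le/ltW.
have [N NP] := choice agree.
pose x : baire_space R := fun k => (u (N k.+1) : nat -> nat) k.
exists x; apply/metricType_numDomainType.cvgrPdist_lt => e e0.
have [n ne] := pow2V_lt e0.
exists (\max_(k < n.+1) N k)%N => // i /= Ni; apply: le_lt_trans ne.
apply/baire_dist_le => k kn; apply: (NP k.+1) => //.
by apply: leq_trans Ni; exact: (leq_bigmax (Ordinal (kn : (k.+1 < n.+1)%N))).
Qed.

End BaireComputable.

(* Main.v *)
(** Everything is expressed by Sigma_1 predicates of an oracle: open sets that are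
    Sigma_1 in a name are enumerated by cylinders (use principle), and universal
    quantification over Cantor space preserves Sigma_1 (compactness).

    From [X] to Baire space: a closed set [A] has uncountably many points in a
    ball iff there is a Cantor scheme inside of [A] and the ball, and the set of
    schemes is closed in Baire space, uniformly in a negative name of [A]. For
    every ball one puts into Baire space a marker point that is a limit of copies
    of (schemes x Baire space). The marker survives in the perfect kernel iff there
    is a scheme, and its absence is semi-decidable from a negative name of the
    kernel.

    From Baire space to [X]: Baire space embeds into Cantor space with countable
    complement, so a closed set [C] extends to a closed subset of Cantor space
    with at most countably many additional points. The image [A] of the latter in
    [X] is compact, hence has a computable negative name, and the kernel of [C] is
    the preimage of the kernel of [A]. *)

From Stdlib Require Import Cantor.
Require Import Defs.
From mathcomp Require Import all_boot all_order all_algebra.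
From mathcomp Require Import all_classical all_reals topology.
From mathcomp Require Import zify lra.
(* Imported again because [topology] also defines an [eval]. *)
Require Import Defs.

Set Implicit Arguments.
Unset Strict Implicit.
Unset Printing Implicit Defensive.

Import Order.TTheory GRing.Theory Num.Theory.

(** * Functions and Sigma_1 predicates relative to an oracle *)

Section OracleFunctions.
Local Open Scope nat_scope.

Implicit Types (F G H : baire -> nat -> nat) (p o : baire).

(** Uniformity in the oracle: one program serves all oracles and halts with each of them. Totality
    is what makes substitution and definition by cases unconditional. *)
Definition rtot F : Prop := exists e, forall p n, eval p e n (F p n).

Lemma rtot_ext F G : (forall p n, F p n = G p n) -> rtot F -> rtot G.
Proof. by move=> FG [e eP]; exists e => p n; rewrite -FG. Qed.

Lemma rtot_tot (f : nat -> nat) F : tot f -> rtot F -> rtot (fun p n => f (F p n)).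
Proof. by move=> [a aP] [b bP]; exists (CComp a b) => p n /=; exists (F p n). Qed.

Lemma rtot_comp F G : rtot F -> rtot G -> rtot (fun p n => F p (G p n)).
Proof. by move=> [a aP] [b bP]; exists (CComp a b) => p n /=; exists (G p n). Qed.

Lemma rtot_pair F G : rtot F -> rtot G -> rtot (fun p n => cpair (F p n) (G p n)).
Proof.
by move=> [a aP] [b bP]; exists (CPair a b) => p n /=; exists (F p n), (G p n).
Qed.

Lemma rtot_fst F : rtot F -> rtot (fun p n => cfst (F p n)).
Proof. exact/rtot_tot/tot_fst/tot_id. Qed.

Lemma rtot_snd F : rtot F -> rtot (fun p n => csnd (F p n)).
Proof. exact/rtot_tot/tot_snd/tot_id. Qed.

Lemma rtot_succ F : rtot F -> rtot (fun p n => (F p n).+1).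
Proof. exact/rtot_tot/tot_succ/tot_id. Qed.

Lemma rtot_pred F : rtot F -> rtot (fun p n => (F p n).-1).
Proof. exact/rtot_tot/tot_pred/tot_id. Qed.

Lemma rtot_const k : rtot (fun _ _ => k).
Proof. by have [e eP] := tot_const k; exists e. Qed.

Lemma rtot_id : rtot (fun _ n => n).
Proof. by have [e eP] := tot_id; exists e. Qed.

Lemma rtot_oracle F : rtot F -> rtot (fun p n => p (F p n)).
Proof. by move=> [e eP]; exists (CComp COracle e) => p n /=; exists (F p n). Qed.

Lemma rtot_prec F G (b : baire -> nat -> nat -> nat -> nat) :
  rtot F -> rtot G ->
  rtot (fun p t => b p (cfst t) (cfst (csnd t)) (csnd (csnd t))) ->
  rtot (fun p n => prec (F p n) (b p n) (G p n)).
Proof.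
move=> [ea aP] [ek kP] [eb bP].
have [ei iP] := tot_id.
exists (CComp (CRec ea eb) (CPair ei ek)) => p n.
exists (cpair n (G p n)); split; first by exists n, (G p n).
rewrite /= csnd_pair cfst_pair; elim: (G p n) => [|i IH] /=; first exact: aP.
exists (prec (F p n) (b p n) i); split => //.
by have := bP p (cpair n (cpair i (prec (F p n) (b p n) i)));
   rewrite !(cfst_pair, csnd_pair).
Qed.

Lemma rtot_tot2 (f : nat -> nat -> nat) F G :
  tot (fun n => f (cfst n) (csnd n)) -> rtot F -> rtot G ->
  rtot (fun p n => f (F p n) (G p n)).
Proof.
move=> tf tF tG; apply: rtot_ext (rtot_tot tf (rtot_pair tF tG)) => p n.
by rewrite cfst_pair csnd_pair.
Qed.

Let t1 : tot cfst. Proof. exact/tot_fst/tot_id. Qed.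
Let t2 : tot csnd. Proof. exact/tot_snd/tot_id. Qed.

Lemma rtot_add F G : rtot F -> rtot G -> rtot (fun p n => F p n + G p n).
Proof. exact/rtot_tot2/tot_add. Qed.

Lemma rtot_sub F G : rtot F -> rtot G -> rtot (fun p n => F p n - G p n).
Proof. exact/rtot_tot2/tot_sub. Qed.

Lemma rtot_exp2 F : rtot F -> rtot (fun p n => 2 ^ F p n).
Proof. exact/rtot_tot/tot_exp2/tot_id. Qed.

Lemma rtot_baire_seq F G :
  rtot F -> rtot G -> rtot (fun p n => baire_seq (F p n) (G p n)).
Proof. exact/rtot_tot2/tot_baire_seq. Qed.

Lemma rtot_if0 H F G : rtot H -> rtot F -> rtot G ->
  rtot (fun p n => if H p n == 0 then F p n else G p n).
Proof.
move=> tH tF tG.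
apply: (@rtot_ext (fun p n => prec (F p n) (fun _ _ => G p n) (H p n))).
  by move=> p n; case: (H p n).
apply: (rtot_prec (b := fun p n _ _ => G p n)) => //.
exact/rtot_comp/rtot_fst/rtot_id.
Qed.

Lemma rtot_mul F G : rtot F -> rtot G -> rtot (fun p n => F p n * G p n).
Proof.
move=> tF tG.
apply: (@rtot_ext (fun p n => prec 0 (fun _ r => r + G p n) (F p n))).
  by move=> p n; elim: (F p n) => //= k ->; rewrite mulSnr.
apply: (rtot_prec (b := fun p n _ r => r + G p n)) => //.
  exact: rtot_const.
apply: rtot_add; first exact/rtot_snd/rtot_snd/rtot_id.
exact/rtot_comp/rtot_fst/rtot_id.
Qed.

Lemma rtot_eq0 F : rtot F -> rtot (fun p n => F p n == 0 : nat).
Proof.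
move=> tF; apply: (rtot_ext _ (rtot_if0 tF (rtot_const 1) (rtot_const 0))).
by move=> p n; case: eqP.
Qed.

Lemma rtot_leq F G : rtot F -> rtot G -> rtot (fun p n => F p n <= G p n : nat).
Proof. by move=> tF tG; apply: rtot_eq0; exact: rtot_sub. Qed.

Lemma rtot_div F G : rtot F -> rtot G -> rtot (fun p n => F p n %/ (G p n).+1).
Proof.
move=> tF tG.
apply: (@rtot_ext (fun p n =>
  prec 0 (fun _ r => r + (r.+1 * (G p n).+1 <= F p n)) (F p n))).
  move=> p n; set m := F p n; set d := (G p n).+1.
  have d0 : 0 < d by [].
  (* The recursion counts how many multiples of [d] fit below [m], so the counter stops growing at
     the quotient. *)
  suff -> k : prec 0 (fun _ r => r + (r.+1 * d <= m)) k = minn k (m %/ d).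
    by apply/minn_idPr; exact: leq_div.
  elim: k => [|k /= ->]; first by rewrite min0n.
  rewrite -leq_divRL //; case: (leqP k (m %/ d)) => h.
    by case: (ltnP k (m %/ d)) => h'; lia.
  by case: (ltnP (m %/ d) (m %/ d)) => h'; lia.
apply: (rtot_prec (b := fun p n _ r => r + (r.+1 * (G p n).+1 <= F p n))) => //.
  exact: rtot_const.
have tr : rtot (fun _ t => csnd (csnd t)) by exact/rtot_snd/rtot_snd/rtot_id.
apply: rtot_add => //; apply: rtot_leq; last exact/rtot_comp/rtot_fst/rtot_id.
apply: rtot_mul; first exact: rtot_succ.
by apply: rtot_succ; exact/rtot_comp/rtot_fst/rtot_id.
Qed.

End OracleFunctions.

Create HintDb rtot discriminated.
#[local] Hint Resolve rtot_pair rtot_fst rtot_snd rtot_succ rtot_pred rtot_const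
  rtot_id rtot_oracle rtot_add rtot_sub rtot_exp2 rtot_baire_seq rtot_mul rtot_leq
  rtot_div : rtot.

Ltac rt := solve [auto 30 with rtot nocore].

(** * Closure properties of Sigma_1 predicates, and evaluation as a Sigma_1 relation *)

Section Sigma1.
Local Open Scope nat_scope.

Implicit Types (F G H : baire -> nat -> nat) (p o : baire).
Implicit Types (V W : baire -> nat -> Prop) (R : nat -> nat -> Prop).

(** Semi-decidability uniformly in the oracle, in normal form: a search for a zero of a total
    function. *)
Definition sd W : Prop := exists F, rtot F /\
  forall p n, W p n <-> exists k, F p (cpair n k) = 0.

Lemma sd_ext V W : (forall p n, V p n <-> W p n) -> sd V -> sd W.
Proof. by move=> VW [F [tF FP]]; exists F; split => // p n; rewrite -VW. Qed.

Lemma sd_leq F G : rtot F -> rtot G -> sd (fun p n => F p n <= G p n).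
Proof.
move=> tF tG; exists (fun p t => F p (cfst t) - G p (cfst t)); split.
  by apply: rtot_sub; exact/rtot_comp/rtot_fst/rtot_id.
move=> p n; split=> [|[k]].
  by exists 0; apply/eqP; rewrite cfst_pair.
by rewrite cfst_pair => /eqP.
Qed.

Lemma sd_eq F G : rtot F -> rtot G -> sd (fun p n => F p n = G p n).
Proof.
move=> tF tG; apply: (@sd_ext (fun p n =>
    (F p n - G p n) + (G p n - F p n) <= 0)).
  by move=> p n; split=> [|->]; lia.
by apply: sd_leq; [apply: rtot_add; exact: rtot_sub | exact: rtot_const].
Qed.

Lemma sd_sub W F : sd W -> rtot F -> sd (fun p n => W p (F p n)).
Proof.
move=> [H [tH HP]] tF.
exists (fun p t => H p (cpair (F p (cfst t)) (csnd t))); split.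
  apply: rtot_comp => //; apply: rtot_pair; last exact/rtot_snd/rtot_id.
  exact/rtot_comp/rtot_fst/rtot_id.
by move=> p n; rewrite HP; split=> -[k] h; exists k; move: h;
  rewrite cfst_pair csnd_pair.
Qed.

Lemma sd_sub3 (W : baire -> nat -> nat -> nat -> Prop) F G H :
  sd (fun p t => W p (cfst t) (cfst (csnd t)) (csnd (csnd t))) ->
  rtot F -> rtot G -> rtot H -> sd (fun p n => W p (F p n) (G p n) (H p n)).
Proof.
move=> sW tF tG tH.
apply: sd_ext (sd_sub sW (rtot_pair tF (rtot_pair tG tH))) => p n.
by rewrite !(cfst_pair, csnd_pair).
Qed.

Lemma sd_ex (W : baire -> nat -> nat -> Prop) :
  sd (fun p t => W p (cfst t) (csnd t)) -> sd (fun p n => exists k, W p n k).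
Proof.
move=> [F [tF FP]].
exists (fun p t =>
  F p (cpair (cpair (cfst t) (cfst (csnd t))) (csnd (csnd t)))); split.
  by apply: rtot_comp => //; rt.
move=> p n; split=> [[k]|[t]].
  have := FP p (cpair n k); rewrite cfst_pair csnd_pair => -> [j h].
  by exists (cpair k j); rewrite !(cfst_pair, csnd_pair).
rewrite cfst_pair !csnd_pair => h; exists (cfst t).
have := FP p (cpair n (cfst t)); rewrite cfst_pair csnd_pair => ->.
by exists (csnd t).
Qed.

Lemma sd_or V W : sd V -> sd W -> sd (fun p n => V p n \/ W p n).
Proof.
move=> [F [tF FP]] [G [tG GP]]; exists (fun p t => F p t * G p t).
split; first exact: rtot_mul.
move=> p n; rewrite FP GP; split=> [[[k h]|[k h]]|[k /eqP]].
- by exists k; rewrite h.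
- by exists k; rewrite h muln0.
- by rewrite muln_eq0 => /orP[] /eqP h; [left|right]; exists k.
Qed.

Lemma sd_and V W : sd V -> sd W -> sd (fun p n => V p n /\ W p n).
Proof.
move=> [F [tF FP]] [G [tG GP]]; exists (fun p t =>
  F p (cpair (cfst t) (cfst (csnd t))) + G p (cpair (cfst t) (csnd (csnd t)))).
split.
  by apply: rtot_add; apply: rtot_comp => //; rt.
move=> p n; rewrite FP GP; split=> [[[k h] [j h']]|[k /eqP]].
  by exists (cpair k j); rewrite !(cfst_pair, csnd_pair) h h'.
by rewrite addn_eq0 !(cfst_pair, csnd_pair) => /andP[/eqP h /eqP h'];
  split; [exists (cfst k) | exists (csnd k)].
Qed.

(* The witnesses for all [j < F p n] are the terms of one coded sequence. *)
Lemma sd_ball (W : baire -> nat -> nat -> Prop) F : rtot F ->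
  sd (fun p t => W p (cfst t) (csnd t)) ->
  sd (fun p n => forall j, j < F p n -> W p n j).
Proof.
move=> tF [G [tG GP]].
exists (fun p t => prec 0 (fun j r => r +
  G p (cpair (cpair (cfst t) j) (baire_seq (csnd t) j))) (F p (cfst t))); split.
  apply: (rtot_prec (b := fun p t j r => r +
    G p (cpair (cpair (cfst t) j) (baire_seq (csnd t) j)))).
  - exact: rtot_const.
  - exact/rtot_comp/rtot_fst/rtot_id.
  - apply: rtot_add; first by rt.
    by apply: rtot_comp => //; rt.
move=> p n; set N := F p n.
have E w k : prec 0 (fun j r => r +
    G p (cpair (cpair n j) (baire_seq w j))) k = 0 <->
    forall j, j < k -> G p (cpair (cpair n j) (baire_seq w j)) = 0.
  elim: k => [|k IH] //=; split.
    move=> /eqP; rewrite addn_eq0 => /andP[/eqP/IH h /eqP h'] j.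
    by rewrite ltnS leq_eqVlt => /orP[/eqP->|/h //].
  move=> h; apply/eqP; rewrite addn_eq0; apply/andP; split; apply/eqP.
    by apply/IH => j jk; apply: h; exact: ltnW.
  by rewrite h.
split=> [h|[w]]; last first.
  rewrite cfst_pair csnd_pair => /E h j jN.
  have := GP p (cpair n j); rewrite cfst_pair csnd_pair => ->.
  by exists (baire_seq w j); exact: h.
have /choice[g gP] : forall j, exists k, j < N -> G p (cpair (cpair n j) k) = 0.
  move=> j; case: (ltnP j N) => [jN|]; last by exists 0.
  have := h j jN; have := GP p (cpair n j); rewrite cfst_pair csnd_pair => ->.
  by move=> [k kP]; exists k.
have [w wP] := baire_alpha_prefix g N.
exists w; rewrite cfst_pair csnd_pair; apply/E => j jN.
by rewrite wP //; exact: gP.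
Qed.

(* The recursion on the counter in [CRec] is replaced by the sequence of its
   values, so that [evalR] is visibly Sigma_1 in [R]. *)
Fixpoint evalR R (e : code) (n m : nat) {struct e} : Prop :=
  match e with
  | CZero => m = 0
  | CSucc => m = n.+1
  | CFst => m = cfst n
  | CSnd => m = csnd n
  | COracle => R n m
  | CPair a b => exists x y, [/\ evalR R a n x, evalR R b n y & m = cpair x y]
  | CComp a b => exists x, evalR R b n x /\ evalR R a x m
  | CRec a b =>
      exists w : nat -> nat, [/\ evalR R a (cfst n) (w 0),
        (forall k, k < csnd n ->
           evalR R b (cpair (cfst n) (cpair k (w k))) (w k.+1)) &
        m = w (csnd n)]
  | CMu a => evalR R a (cpair n m) 0 /\
      forall j, j < m -> exists y, evalR R a (cpair n j) y.+1
  end.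

Lemma evalR_mono R R' e n m : (forall i j, R i j -> R' i j) ->
  evalR R e n m -> evalR R' e n m.
Proof.
move=> RR'; elim: e n m => [||||| a IHa b IHb|a IHa b IHb|a IHa b IHb|a IHa]
  n m //=.
- exact: RR'.
- by move=> [x [y [/IHa ? /IHb ? ->]]]; exists x, y.
- by move=> [x [/IHb ? /IHa ?]]; exists x.
- by move=> [w [/IHa ? h ->]]; exists w; split => // k /h /IHb.
- move=> [/IHa ? h]; split => // j /h [y /IHa ?]; by exists y.
Qed.

Lemma evalRE p e n m : evalR (fun i j => j = p i) e n m <-> eval p e n m.
Proof.
elim: e n m => [||||| a IHa b IHb|a IHa b IHb|a IHa b IHb|a IHa] n m //=.
- by split=> -[x [y [/IHa ? /IHb ? ->]]]; exists x, y.
- by split=> -[x [/IHb ? /IHa ?]]; exists x.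
- elim: (csnd n) m => [|k IH] m /=.
    rewrite -IHa; split=> [[w [h _ ->]] //|h].
    by exists (fun=> m).
  split=> [[w [h0 hS ->]]|[s [/IH [w [h0 hS ->]] /IHb h]]].
    exists (w k); split; last exact/IHb/hS.
    by apply/IH; exists w; split => // i ik; apply: hS; exact: ltnW.
  exists (fun i => if i == k.+1 then m else w i); split => //; last first.
    by rewrite eqxx.
  move=> i; rewrite ltnS eqSS leq_eqVlt; case: (ltngtP i k) => // [ik|->] _.
    by rewrite ltn_eqF; [exact: hS | lia].
  by rewrite ltn_eqF.
- split=> -[/IHa ? h]; split => // j /h [y /IHa ?]; by exists y.
Qed.

(** Only the values up to the counter matter, so a coded eventually zero sequence can replace [w].
    This turns a quantifier over functions into one over numbers. *)
Lemma evalR_rec R a b n m : evalR R (CRec a b) n m <-> exists w,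
  [/\ evalR R a (cfst n) (baire_seq w 0),
     (forall k, k < csnd n -> evalR R b
        (cpair (cfst n) (cpair k (baire_seq w k))) (baire_seq w k.+1)) &
     m = baire_seq w (csnd n)].
Proof.
split=> [[w [h0 hS ->]]|[w ?]]; last by exists (baire_seq w).
have [v vP] := baire_alpha_prefix w (csnd n).+1; exists v; split.
- by rewrite vP.
- move=> k kn; rewrite !vP //; last exact: ltnW.
  exact: hS.
- by rewrite vP.
Qed.

End Sigma1.

Section Eval.
Local Open Scope nat_scope.

(** The oracle of the simulated program is given only by a Sigma_1 graph depending on a parameter.
    This covers finite pieces of an oracle as well as sequences derived from it. *)
Lemma sd_evalR (R : baire -> nat -> nat -> nat -> Prop) e :
  sd (fun o t => R o (cfst t) (cfst (csnd t)) (csnd (csnd t))) ->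
  sd (fun o t => evalR (R o (cfst t)) e (cfst (csnd t)) (csnd (csnd t))).
Proof.
move=> sR; elim: e => [||||| a IHa b IHb|a IHa b IHb|a IHa b IHb|a IHa].
- by apply: sd_eq; rt.
- by apply: sd_eq; rt.
- by apply: sd_eq; rt.
- by apply: sd_eq; rt.
- exact: sR.
- apply: (@sd_ext (fun o t => exists x y,
    (evalR (R o (cfst t)) a (cfst (csnd t)) x /\
     evalR (R o (cfst t)) b (cfst (csnd t)) y) /\ csnd (csnd t) = cpair x y)).
    move=> p n; split=> -[x [y]]; first by move=> [[? ?] ?]; exists x, y.
    by move=> [? ? ?]; exists x, y.
  do 2 apply: sd_ex; apply: sd_and; last by apply: sd_eq; rt.
  apply: sd_and.
  + by apply: (sd_sub3 (W := fun o c n m => evalR (R o c) a n m)) => //; rt.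
  + by apply: (sd_sub3 (W := fun o c n m => evalR (R o c) b n m)) => //; rt.
- apply: sd_ex; apply: sd_and.
  + by apply: (sd_sub3 (W := fun o c n m => evalR (R o c) b n m)) => //; rt.
  + by apply: (sd_sub3 (W := fun o c n m => evalR (R o c) a n m)) => //; rt.
- apply: (@sd_ext (fun o t => exists w,
    (evalR (R o (cfst t)) a (cfst (cfst (csnd t))) (baire_seq w 0) /\
     (forall k, k < csnd (cfst (csnd t)) -> evalR (R o (cfst t)) b
        (cpair (cfst (cfst (csnd t))) (cpair k (baire_seq w k)))
        (baire_seq w k.+1))) /\
     csnd (csnd t) = baire_seq w (csnd (cfst (csnd t))))).
    move=> p n; rewrite evalR_rec.
    by split=> -[w]; [move=> [[? ?] ?] | move=> [? ? ?]]; exists w.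
  apply: sd_ex; apply: sd_and; last by apply: sd_eq; rt.
  apply: sd_and.
  + by apply: (sd_sub3 (W := fun o c n m => evalR (R o c) a n m)) => //; rt.
  + apply: sd_ball; first by rt.
    by apply: (sd_sub3 (W := fun o c n m => evalR (R o c) b n m)) => //; rt.
- apply: sd_and.
  + by apply: (sd_sub3 (W := fun o c n m => evalR (R o c) a n m)) => //; rt.
  + apply: sd_ball; first by rt.
    apply: sd_ex.
    by apply: (sd_sub3 (W := fun o c n m => evalR (R o c) a n m)) => //; rt.
Qed.

End Eval.

(** * The use principle and compactness of Cantor space *)

Section FiniteUse.
Local Open Scope nat_scope.

Implicit Types (p x : baire) (W : baire -> nat -> Prop).

Definition upto (L : nat) p : nat -> nat -> Prop := fun i j => i < L /\ j = p i.

Lemma upto_mono L M p q i j : L <= M -> (forall k, k < L -> p k = q k) ->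
  upto L p i j -> upto M q i j.
Proof. by move=> LM pq [iL ->]; split; [exact: leq_trans LM | exact: pq]. Qed.

Lemma evalR_upto_eval L p q e n m : (forall k, k < L -> p k = q k) ->
  evalR (upto L p) e n m -> eval q e n m.
Proof.
by move=> pq h; apply/evalRE; apply: evalR_mono h => i j [/pq <- ->].
Qed.

Lemma ex_bounded (P : nat -> nat -> Prop) K :
  (forall k L M, L <= M -> P k L -> P k M) ->
  (forall k, k < K -> exists L, P k L) -> exists L, forall k, k < K -> P k L.
Proof.
move=> mono; elim: K => [|K IH] h; first by exists 0.
have [|L hL] := IH; first by move=> k kK; apply: h; exact: ltnW.
have [M hM] := h K (ltnSn K).
exists (maxn L M) => k; rewrite ltnS leq_eqVlt => /orP[/eqP->|/hL].
  by apply: mono hM; exact: leq_maxr.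
by apply: mono; exact: leq_maxl.
Qed.

(** A halting computation asks finitely many questions; the bounds for its subcomputations are
    merged by taking maxima. *)
Lemma eval_finite_use p e n m : eval p e n m -> exists L, evalR (upto L p) e n m.
Proof.
have mono e' n' m' L M : L <= M -> evalR (upto L p) e' n' m' ->
    evalR (upto M p) e' n' m'.
  by move=> LM; apply: evalR_mono => i j; exact: upto_mono.
move=> /evalRE.
elim: e n m => [||||| a IHa b IHb|a IHa b IHb|a IHa b IHb|a IHa] n m.
1-4: by exists 0.
- by move=> /= ->; exists n.+1; split.
- move=> /= [x [y [/IHa[L hL] /IHb[M hM] ->]]]; exists (maxn L M), x, y; split=> //.
    by apply: mono hL; exact: leq_maxl.
  by apply: mono hM; exact: leq_maxr.
- move=> /= [x [/IHb[L hL] /IHa[M hM]]]; exists (maxn L M), x; split.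
    by apply: mono hL; exact: leq_maxl.
  by apply: mono hM; exact: leq_maxr.
- move=> /= [w [/IHa[L hL] h ->]].
  have [|k kn|M hM] := @ex_bounded (fun k M => evalR (upto M p) b
    (cpair (cfst n) (cpair k (w k))) (w k.+1)) (csnd n).
  + by move=> k L1 L2; exact: mono.
  + by have /IHb := h _ kn.
  exists (maxn L M), w; split => //; first by apply: mono hL; exact: leq_maxl.
  by move=> k /hM; apply: mono; exact: leq_maxr.
- move=> /= [/IHa[L hL] h].
  have [|k kn|M hM] := @ex_bounded (fun k M => exists y, evalR (upto M p) a
    (cpair n k) y.+1) m.
  + by move=> k L1 L2 L12 [y hy]; exists y; exact: mono L12 hy.
  + by have [y /IHa[M hM]] := h _ kn; exists M, y.
  exists (maxn L M); split; first by apply: mono hL; exact: leq_maxl.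
  by move=> k /hM[y hy]; exists y; apply: mono hy; exact: leq_maxr.
Qed.

Lemma interleave_prefix p x y L : (forall k, k < L -> x k = y k) ->
  forall k, k < L -> interleave p x k = interleave p y k.
Proof.
move=> xy k kL; rewrite /interleave; case: odd => //; apply: xy.
by apply: leq_ltn_trans kL; rewrite -divn2 leq_div.
Qed.

Lemma rtot_odd F : rtot F -> rtot (fun p n => odd (F p n) : nat).
Proof.
move=> tF; apply: (@rtot_ext (fun p n => F p n - 2 * (F p n %/ 1.+1))).
  by move=> p n; rewrite divn2 mul2n -{1}[F p n]odd_double_half addnK.
by rt.
Qed.

Lemma rtot_interleave (s : baire -> nat -> baire) (F G : baire -> nat -> nat) :
  rtot (fun p t => s p (cfst t) (csnd t)) -> rtot F -> rtot G ->
  rtot (fun p n => interleave p (s p (F p n)) (G p n)).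
Proof.
move=> ts tF tG; apply: (@rtot_ext (fun p n =>
    if (odd (G p n) : nat) == 0 then p (G p n %/ 1.+1)
    else s p (F p n) (G p n %/ 1.+1))).
  by move=> p n; rewrite /interleave divn2; case: odd.
apply: rtot_if0; [exact: rtot_odd | by rt |].
apply: (@rtot_ext (fun p n => (fun q t => s q (cfst t) (csnd t)) p
    (cpair (F p n) (G p n %/ 1.+1)))).
  by move=> p n; rewrite cfst_pair csnd_pair.
by apply: (rtot_comp ts); rt.
Qed.

Lemma sd_upto_eval (s : baire -> nat -> baire) e (M : baire -> nat -> nat) :
  rtot (fun p t => s p (cfst t) (csnd t)) -> rtot M ->
  sd (fun p t => exists k, evalR (upto (M p t) (interleave p (s p t))) e
                             (cpair (cfst t) k) 0).
Proof.
move=> ts tM; apply: sd_ex.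
apply: (sd_sub3 (W := fun p t n m =>
  evalR (upto (M p t) (interleave p (s p t))) e n m)); try by rt.
apply: (@sd_evalR (fun p t i j =>
  i < M p t /\ j = interleave p (s p t) i)).
have tMc : rtot (fun p t => M p (cfst t)) by apply: rtot_comp => //; rt.
apply: sd_and; first by apply: sd_leq; rt.
apply: sd_eq; first by rt.
by apply: rtot_interleave => //; rt.
Qed.

(* By the use principle, an open set that is Sigma_1 in [p] is a union of
   cylinders (of positive length) enumerated by [p]. *)
Lemma sd_cylinders W : sd W -> exists V, sd V /\ forall p x n,
  W (interleave p x) n <-> exists t, V p (cpair n t) /\
    forall k, k < (csnd t).+1 -> x k = baire_seq (cfst t) k.
Proof.
move=> [F [[e eP] FP]].
exists (fun p t => exists k, evalR
  (upto (csnd (csnd t)).+1 (interleave p (baire_seq (cfst (csnd t))))) e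
  (cpair (cfst t) k) 0); split.
  apply: (@sd_upto_eval (fun p t => baire_seq (cfst (csnd t))) e); by rt.
move=> p x n; rewrite FP; split=> [[k Fk]|[t]]; last first.
  rewrite cfst_pair !csnd_pair => -[[k ev] xt]; exists k.
  apply: eval_functional (eP _ _) _; apply: evalR_upto_eval ev.
  by apply: interleave_prefix => i /xt ->.
have := eP (interleave p x) (cpair n k); rewrite Fk => /eval_finite_use[L ev].
have [i iP] := baire_alpha_prefix x L.+1.
(* The second component [L] stands for a cylinder of length [L.+1], which is the open ball of radius
   [2 ^- L] in Baire space. *)
exists (cpair i L); rewrite cfst_pair !(cfst_pair, csnd_pair).
split; last by move=> j /iP ->.
exists k; apply: evalR_mono ev => a b; apply: upto_mono => // j jL.
by apply: (@interleave_prefix _ _ _ L) => // l lL; rewrite iP // ltnW.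
Qed.

(** Sequential compactness: a string extended by terms of arbitrarily large index is prolonged bit
    by bit, keeping this property. *)
Lemma cantor_cluster (v : nat -> nat -> bool) : exists u : nat -> bool,
  forall n, exists2 N, n <= N & forall k, k < n -> v N k = u k.
Proof.
pose Inf (t : seq bool) := forall n, exists2 N, n <= N &
  forall k, k < size t -> v N k = nth false t k.
have step t : exists b, Inf t -> Inf (rcons t b).
  have [h|h] := pselect (Inf (rcons t true)); first by exists true.
  (* If no index from [n] on extended [t] by false, all later ones extending [t] would extend it by
     true, against [h]. *)
  exists false => It n; apply: contrapT => hn; apply: h => m.
  have [N mN eqN] := It (maxn n m); move: mN; rewrite geq_max => /andP[nN mN].
  exists N => // k; rewrite size_rcons ltnS leq_eqVlt => /orP[/eqP->|kt].
    rewrite nth_rcons ltnn eqxx; apply: contrapT => /negP/negbTE vN.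
    apply: hn; exists N => // j; rewrite size_rcons ltnS leq_eqVlt.
    by move=> /orP[/eqP->|jt]; rewrite nth_rcons ?ltnn ?eqxx ?jt // eqN.
  by rewrite nth_rcons kt eqN.
have [g gP] := choice step.
pose T n := iter n (fun t => rcons t (g t)) [::].
have sT n : size (T n) = n by elim: n => //= n IH; rewrite size_rcons IH.
have IT n : Inf (T n) by elim: n => [n|n IH]; [by exists n | exact: gP].
have nT n k : k < n -> nth false (T n) k = g (T k).
  elim: n => // n IH; rewrite ltnS leq_eqVlt => /orP[/eqP->|kn] /=.
    by rewrite nth_rcons sT ltnn eqxx.
  by rewrite nth_rcons sT kn IH.
exists (fun k => g (T k)) => n; have [N nN eqN] := IT n n.
by exists N => // k kn; rewrite eqN ?sT // nT.
Qed.

Lemma bits_prefix (u : nat -> bool) M :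
  exists2 s, s < 2 ^ M & forall i, i < M -> odd (s %/ 2 ^ i) = u i.
Proof.
elim: M u => [|M IH] u; first by exists 0.
have [s sM sP] := IH (fun i => u i.+1).
exists (u 0 + s.*2); first by rewrite expnS; case: (u 0); lia.
move=> [_|i iM]; first by rewrite expn0 divn1 oddD odd_double addbF oddb.
by rewrite expnS divnMA divn2 half_bit_double sP.
Qed.

(* Compactness of Cantor space: a Sigma_1 property of all its points is already
   witnessed by the strings of one length. *)
Lemma sd_cantor_forall W : sd W ->
  sd (fun p n => forall u : nat -> bool, W (interleave p u) n).
Proof.
move=> [F [[e eP] FP]].
pose s t : nat -> bool := fun i => odd (csnd t %/ 2 ^ i).
have E p n : (forall u : nat -> bool, W (interleave p u) n) <->
    exists M, forall j, j < 2 ^ M -> exists k, evalR (upto M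
      (interleave p (fun i => odd (j %/ 2 ^ i)))) e (cpair n k) 0.
  split=> [h|[M MP] u]; last first.
    have [j jM ju] := bits_prefix u M; have [k ev] := MP _ jM.
    apply/FP; exists k; apply: eval_functional (eP _ _) _.
    apply: evalR_upto_eval ev.
    by apply: interleave_prefix => i iM; rewrite ju.
  apply: contrapT => hM.
  (* If no length works, choose a bad string for every [M]. The run at a cluster point of these
     strings reads only [L] bits, and some bad string of index at least [L] agrees with the cluster
     point there. *)
  have /choice[j jP] : forall M, exists j, forall k, ~ evalR (upto M
      (interleave p (fun i => odd (j %/ 2 ^ i)))) e (cpair n k) 0.
    move=> M; apply: contrapT => hj; apply: hM; exists M => j jM.
    by apply: contrapT => hk; apply: hj; exists j => k ev; apply: hk; exists k.
  have [u uP] := cantor_cluster (fun M i => odd (j M %/ 2 ^ i)).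
  have /FP[k Fk] := h u.
  have := eP (interleave p u) (cpair n k); rewrite Fk => /eval_finite_use[L ev].
  have [N LN eqN] := uP L.
  apply: (jP N k); apply: evalR_mono ev => a b; apply: upto_mono => //.
  by apply: interleave_prefix => i iL; rewrite eqN.
apply: sd_ext; first by move=> p n; rewrite E; exact: iff_refl.
apply: sd_ex; apply: sd_ball; first by rt.
apply: (sd_sub3 (W := fun p n M j => exists k, evalR (upto M
  (interleave p (fun i => odd (j %/ 2 ^ i)))) e (cpair n k) 0)); try by rt.
apply: (@sd_upto_eval (fun p t i => odd (csnd (csnd t) %/ 2 ^ i))); last by rt.
apply: rtot_odd; apply: (@rtot_ext (fun p t =>
    csnd (csnd (cfst t)) %/ (2 ^ (csnd t)).-1.+1)); last by rt.
by move=> p n; rewrite prednK // expn_gt0.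
Qed.

End FiniteUse.

(** * Distances and names in computable metric spaces *)

(** [computable_nat] speaks of the zero oracle, [tot] of all oracles; answering every query by 0
    leads from one to the other. *)
Fixpoint zero_oracle (e : code) : code :=
  match e with
  | COracle => CZero
  | CPair a b => CPair (zero_oracle a) (zero_oracle b)
  | CComp a b => CComp (zero_oracle a) (zero_oracle b)
  | CRec a b => CRec (zero_oracle a) (zero_oracle b)
  | CMu a => CMu (zero_oracle a)
  | e => e
  end.

Lemma eval_zero_oracle e p n m :
  eval (fun=> 0%N) e n m -> eval p (zero_oracle e) n m.
Proof.
elim: e n m => [||||| a IHa b IHb|a IHa b IHb|a IHa b IHb|a IHa] n m //=.
- by move=> [x [y [/IHa ? /IHb ? ->]]]; exists x, y.
- by move=> [x [/IHb ? /IHa ?]]; exists x.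
- elim: (csnd n) m => [|k IHk] m; first exact: IHa.
  by move=> [s [/IHk ? /IHb ?]]; exists s.
- move=> [/IHa ? h]; split => // j /h [y /IHa ?]; by exists y.
Qed.

Lemma computable_nat_tot f : computable_nat f -> tot f.
Proof.
by move=> [e eP]; exists (zero_oracle e) => p n; exact/eval_zero_oracle/eP.
Qed.

Local Open Scope classical_set_scope.
Local Open Scope ring_scope.

Lemma rat_enumE m : rat_enum m =
  ((cfst (cfst m))%:R - (csnd (cfst m))%:R) / (csnd m).+1%:R.
Proof.
rewrite /rat_enum /cfst /csnd; case: (Cantor.of_nat m) => a c /=.
by case: Cantor.of_nat.
Qed.

(** The predecessor compensates for the successor that [rat_enum] applies to the denominator. *)
Definition pow2V_index (n : nat) : nat := cpair (cpair 1 0) (2 ^ n).-1.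

Lemma rat_enum_pow2V n : rat_enum (pow2V_index n) = 2 ^- n.
Proof.
rewrite rat_enumE !(cfst_pair, csnd_pair) subr0 mul1r prednK ?expn_gt0 //.
by rewrite natrX.
Qed.

Section ComputableMetric.
Variables (R : realType) (X : computableMetricSpace R).
Local Notation alpha := (cms_seq X).
Implicit Types (F G H A B : baire -> nat -> nat) (V : baire -> nat -> Prop).

Lemma ratr_pow2V_index n : ratr (rat_enum (pow2V_index n)) = 2 ^- n :> R.
Proof. by rewrite rat_enum_pow2V fmorphV rmorphXn /= ratr_nat. Qed.

(** Integer approximations of scaled distances reduce later comparisons to arithmetic of natural
    numbers. Of the error 2, one unit comes from the rational approximation and one from rounding
    down. *)
Lemma dist_approx : exists D : nat -> nat -> nat -> nat,
  (forall F G H, rtot F -> rtot G -> rtot H ->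
     rtot (fun p n => D (F p n) (G p n) (H p n))) /\
  forall i j k, (D i j k)%:R <= 2 ^+ k * mdist (alpha i) (alpha j) + 2 /\
    2 ^+ k * mdist (alpha i) (alpha j) <= (D i j k)%:R + 2.
Proof.
have [a [/computable_nat_tot ta aP]] := cms_computable X.
pose r i j k := a (cpair (cpair i j) k).
exists (fun i j k => ((cfst (cfst (r i j k)) - csnd (cfst (r i j k))) * 2 ^ k)
  %/ (csnd (r i j k)).+1)%N; split.
  move=> F G H tF tG tH.
  have tr : rtot (fun p n => r (F p n) (G p n) (H p n)).
    by apply: (rtot_tot ta); rt.
  by rt.
move=> i j k; have := aP i j k; rewrite -/(r i j k) rat_enumE.
set x := cfst (cfst _); set y := csnd (cfst _); set c := csnd _.
rewrite fmorph_div rmorphB /= !ratr_nat.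
set d := mdist _ _; have d0 : 0 <= d by exact: mdist_ge0.
set D := (_ %/ _)%N.
have h1 : (D%:R * c.+1%:R <= (x - y)%:R * 2 ^+ k :> R).
  by rewrite -natrX -!natrM ler_nat leq_trunc_div.
have h2 : ((x - y)%:R * 2 ^+ k < (D%:R + 1) * c.+1%:R :> R).
  by rewrite natr1 -natrX -!natrM ltr_nat ltn_ceil.
have c0 : 0 < c.+1%:R :> R by rewrite ltr0n.
have p0 : 0 < 2 ^+ k :> R by rewrite exprn_gt0.
have hd : `|d - (x - y)%:R / c.+1%:R| <= 2 ^- k ->
    D%:R <= 2 ^+ k * d + 2 /\ 2 ^+ k * d <= D%:R + 2.
  set q := _ / _; move=> dq.
  have qE : q * c.+1%:R = (x - y)%:R by rewrite divfK // lt0r_neq0.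
  rewrite -qE mulrAC ler_pM2r // in h1; rewrite -qE mulrAC ltr_pM2r // in h2.
  have : `|2 ^+ k * d - q * 2 ^+ k| <= 1.
    rewrite [q * _]mulrC -mulrBr normrM gtr0_norm //.
    by rewrite -[leRHS](mulfV (lt0r_neq0 p0)) ler_pM2l.
  by rewrite ler_norml => /andP[? ?]; lra.
have [xy|xy] := leqP y x; first by rewrite -natrB //; exact: hd.
(* A negative approximation is truncated to 0, which is at least as close because distances are
   nonnegative. *)
move=> h; apply: hd; have -> : (x - y)%N = 0%N by lia.
rewrite mul0r subr0 ger0_norm //; apply: le_trans h; apply: le_trans (ler_norm _).
rewrite lerDl oppr_ge0 pmulr_lle0 ?invr_gt0 //.
by rewrite subr_le0 ler_nat ltnW.
Qed.

Lemma pow2_gt (x : R) : exists k, x < 2 ^+ k.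
Proof.
have [x0|x0] := lerP x 0; first by exists 0%N; apply: le_lt_trans x0 _; rewrite expr0.
have xV0 : 0 < x^-1 by rewrite invr_gt0.
have [k kP] := pow2V_lt xV0.
by exists k; move: kP; rewrite ltf_pV2 // posrE exprn_gt0.
Qed.

(** A strict inequality leaves a gap, so it is certified by the upper bound [D + 2] at a fine enough
    scale. *)
Lemma sd_dist_lt F G A B : rtot F -> rtot G -> rtot A -> rtot B ->
  (forall p n, (0 < B p n)%N) ->
  sd (fun p n => mdist (alpha (F p n)) (alpha (G p n))
                   < (A p n)%:R / (B p n)%:R).
Proof.
move=> tF tG tA tB B0; have [D [tD DP]] := dist_approx.
apply: (@sd_ext (fun p n => exists k,
    ((D (F p n) (G p n) k + 2) * B p n).+1 <= A p n * 2 ^ k)%N); last first.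
  have tc H : rtot H -> rtot (fun p t => H p (cfst t)).
    by move=> tH; apply: (rtot_comp tH); rt.
  have := (tc _ tF, tc _ tG, tc _ tA, tc _ tB) => -[[[? ?] ?] ?].
  apply: sd_ex; apply: sd_leq; last by rt.
  have ? : rtot (fun p t => D (F p (cfst t)) (G p (cfst t)) (csnd t)).
    by apply: tD => //; rt.
  by rt.
move=> p n; set b := B p n; set a := A p n; set d := mdist _ _.
have b0 : 0 < b%:R :> R by rewrite ltr0n B0.
have E k : ((D (F p n) (G p n) k + 2) * b < a * 2 ^ k)%N =
    (((D (F p n) (G p n) k)%:R + 2) * b%:R < a%:R * 2 ^+ k :> R).
  by rewrite -natrX -natrD -!natrM ltr_nat.
rewrite ltr_pdivlMr //; split=> [[k]|dlt].
  rewrite E => h; have := DP (F p n) (G p n) k; rewrite -/d => -[h1 h2].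
  have p0 : 0 < 2 ^+ k :> R by rewrite exprn_gt0.
  rewrite -(ltr_pM2l p0) mulrA mulrC [ltRHS]mulrC; apply: le_lt_trans h.
  by rewrite mulrC ler_pM2r.
(* The 4 adds the error 2 of [D] to the margin 2 in the certificate. *)
have [k kP] := pow2_gt (4 * b%:R / (a%:R - d * b%:R)).
exists k; rewrite E; have := DP (F p n) (G p n) k; rewrite -/d => -[h1 h2].
rewrite ltr_pdivrMr ?subr_gt0 // in kP.
apply: le_lt_trans (_ : (2 ^+ k * d + 4) * b%:R < _).
  by rewrite ler_pM2r //; lra.
by lra.
Qed.

Lemma sd_dist_gt F G A B : rtot F -> rtot G -> rtot A -> rtot B ->
  (forall p n, (0 < B p n)%N) ->
  sd (fun p n => (A p n)%:R / (B p n)%:R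
                   < mdist (alpha (F p n)) (alpha (G p n))).
Proof.
move=> tF tG tA tB B0; have [D [tD DP]] := dist_approx.
apply: (@sd_ext (fun p n => exists k,
    (A p n * 2 ^ k + 2 * B p n).+1 <= D (F p n) (G p n) k * B p n)%N); last first.
  have tc H : rtot H -> rtot (fun p t => H p (cfst t)).
    by move=> tH; apply: (rtot_comp tH); rt.
  have := (tc _ tF, tc _ tG, tc _ tA, tc _ tB) => -[[[? ?] ?] ?].
  apply: sd_ex; apply: sd_leq; first by rt.
  have ? : rtot (fun p t => D (F p (cfst t)) (G p (cfst t)) (csnd t)).
    by apply: tD => //; rt.
  by rt.
move=> p n; set b := B p n; set a := A p n; set d := mdist _ _.
have b0 : 0 < b%:R :> R by rewrite ltr0n B0.
have E k : (a * 2 ^ k + 2 * b < D (F p n) (G p n) k * b)%N =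
    (a%:R * 2 ^+ k + 2 * b%:R < (D (F p n) (G p n) k)%:R * b%:R :> R).
  by rewrite -natrX -!natrM -natrD ltr_nat.
rewrite ltr_pdivrMr //; split=> [[k]|dlt].
  rewrite E => h; have := DP (F p n) (G p n) k; rewrite -/d => -[h1 h2].
  have p0 : 0 < 2 ^+ k :> R by rewrite exprn_gt0.
  rewrite -(ltr_pM2l p0) [ltRHS]mulrA.
  have : (D (F p n) (G p n) k)%:R * b%:R <= (2 ^+ k * d + 2) * b%:R.
    by rewrite ler_pM2r.
  by lra.
have [k kP] := pow2_gt (4 * b%:R / (d * b%:R - a%:R)).
exists k; rewrite E; have := DP (F p n) (G p n) k; rewrite -/d => -[h1 h2].
rewrite ltr_pdivrMr ?subr_gt0 // in kP.
apply: lt_le_trans (_ : (2 ^+ k * d - 2) * b%:R <= _); last first.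
  by rewrite ler_pM2r //; lra.
by lra.
Qed.

Lemma sd_dist_lt_pow2V F G H : rtot F -> rtot G -> rtot H ->
  sd (fun p n => mdist (alpha (F p n)) (alpha (G p n)) < 4 * 2 ^- H p n).
Proof.
move=> tF tG tH; have := @sd_dist_lt F G (fun _ _ => 4%N) (fun p n => 2 ^ H p n)%N.
move=> h; apply: (sd_ext _ (h tF tG _ _ _)); [|by rt|by rt|].
  by move=> p n /=; rewrite natrX.
by move=> p n; rewrite expn_gt0.
Qed.

Lemma sd_dist_gt_pow2V a F G H : rtot F -> rtot G -> rtot H ->
  sd (fun p n => a%:R * 2 ^- H p n < mdist (alpha (F p n)) (alpha (G p n))).
Proof.
move=> tF tG tH; have := @sd_dist_gt F G (fun _ _ => a) (fun p n => 2 ^ H p n)%N.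
move=> h; apply: (sd_ext _ (h tF tG _ _ _)); [|by rt|by rt|].
  by move=> p n /=; rewrite natrX.
by move=> p n; rewrite expn_gt0.
Qed.

(** Formal inclusion of the closed ball of centre [alpha v] and radius [2 ^- n] in the basic ball
    [b]. Unlike true inclusion it is Sigma_1 in the indices. *)
Definition strict_in (v n b : nat) : Prop :=
  mdist (alpha v) (alpha (cfst b)) + 2 ^- n < ratr (rat_enum (csnd b)) :> R.

Lemma sd_strict_in F G H : rtot F -> rtot G -> rtot H ->
  sd (fun p n => strict_in (F p n) (G p n) (H p n)).
Proof.
move=> tF tG tH.
pose x p n := cfst (cfst (csnd (H p n))).
pose y p n := csnd (cfst (csnd (H p n))).
pose c p n := csnd (csnd (H p n)).
have tx : rtot x by rewrite /x; rt.
have ty : rtot y by rewrite /y; rt.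
have tc : rtot c by rewrite /c; rt.
have := @sd_dist_lt F (fun p n => cfst (H p n))
  (fun p n => x p n * 2 ^ G p n - (y p n * 2 ^ G p n + (c p n).+1))%N
  (fun p n => (c p n).+1 * 2 ^ G p n)%N.
move=> h; apply: (sd_ext _ (h tF _ _ _ _)); try by rt.
  move=> p n; rewrite /strict_in rat_enumE -/(x p n) -/(y p n) -/(c p n).
  move: (x p n) (y p n) (c p n) (G p n) => {h} a b m k.
  set d := mdist _ _; have d0 : 0 <= d by exact: mdist_ge0.
  rewrite fmorph_div rmorphB /= !ratr_nat.
  have m0 : 0 < m.+1%:R :> R by rewrite ltr0n.
  have p0 : 0 < 2 ^+ k :> R by rewrite exprn_gt0.
  rewrite ltr_pdivlMr ?ltr0n ?muln_gt0 ?expn_gt0 //.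
  rewrite -[in X in _ <-> X](ltr_pM2r m0) divfK ?lt0r_neq0 //.
  rewrite -[in X in _ <-> X](ltr_pM2r p0).
  rewrite (_ : (d + 2 ^- k) * m.+1%:R * 2 ^+ k =
    d * (m.+1%:R * 2 ^+ k) + m.+1%:R); last first.
    rewrite mulrDl mulrDl -mulrA; congr (_ + _).
    by rewrite mulrAC mulVf ?mul1r // lt0r_neq0.
  have [le|lt] := leqP (b * 2 ^ k + m.+1) (a * 2 ^ k).
    rewrite natrB // natrD !natrM natrX; split; lra.
  (* The truncated difference vanishes, and both inequalities fail because [d] is nonnegative. *)
  rewrite (_ : (_ - _)%N = 0%N); last by lia.
  have : (a * 2 ^ k)%:R < (b * 2 ^ k + m.+1)%:R :> R by rewrite ltr_nat.
  rewrite natrD !natrM natrX => lt'.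
  have ? : 0 <= d * (m.+1%:R * 2 ^+ k) by rewrite !mulr_ge0 // ltW.
  by split; lra.
by move=> p n; rewrite muln_gt0 expn_gt0.
Qed.

Lemma basic_ballE b : basic_ball X b =
  [set x | mdist x (alpha (cfst b)) < ratr (rat_enum (csnd b))].
Proof. by rewrite /basic_ball /cfst /csnd; case: Cantor.of_nat. Qed.

Lemma basic_ball_strict_in b x (p : baire) :
  (forall k, mdist (alpha (p k)) x <= 2 ^- k) ->
  basic_ball X b x <-> exists k, strict_in (p k) k b.
Proof.
move=> px; rewrite basic_ballE /strict_in /=; split=> [h|[k h]].
  (* One half of the slack pays for the distance from [x] to the approximation, the other for the
     margin in [strict_in]. *)
  have e0 : 0 < (ratr (rat_enum (csnd b)) - mdist x (alpha (cfst b))) / 2.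
    by rewrite divr_gt0 ?subr_gt0.
  have [k kP] := pow2V_lt e0; exists k.
  have := metric_triangle (alpha (p k)) x (alpha (cfst b)).
  by have := px k; move=> ? ?; lra.
apply: le_lt_trans h; rewrite addrC.
apply: le_trans (metric_triangle _ (alpha (p k)) _) _.
by rewrite lerD2r metric_sym.
Qed.

Lemma strict_in_sub b v n x :
  strict_in v n b -> mdist (alpha v) x <= 2 ^- n -> basic_ball X b x.
Proof.
rewrite /strict_in basic_ballE /= => h vx.
have := metric_triangle x (alpha v) (alpha (cfst b)).
by rewrite [mdist x (alpha v)]metric_sym => ?; lra.
Qed.

Lemma cvg_dist (u : nat -> X) x : u @ \oo --> x ->
  forall e, 0 < e -> exists N, forall n, (N <= n)%N -> mdist x (u n) < e.
Proof.
move=> /metricType_numDomainType.cvgrPdist_lt h e e0.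
by have [N _ NP] := h e e0; exists N => n; exact: NP.
Qed.

Lemma cvg_dist_le (u : nat -> X) x c r N : u @ \oo --> x ->
  (forall n, (N <= n)%N -> mdist (u n) c <= r) -> mdist x c <= r.
Proof.
move=> /cvg_dist ux h; apply/ler_addgt0Pl => e e0.
have [M MP] := ux e e0; have := MP (maxn N M) (leq_maxr _ _).
have := h (maxn N M) (leq_maxl _ _).
by have := metric_triangle x (u (maxn N M)) c; move=> ? ? ?; lra.
Qed.

Lemma cauchy_name_dist p x k : cauchy_name p x -> mdist (alpha (p k)) x <= 2 ^- k.
Proof.
move=> [pc px]; rewrite metric_sym; apply: (cvg_dist_le (N := k.+1) px) => n kn.
exact/ltW/pc.
Qed.

Lemma dense_near (x : X) e : 0 < e -> exists i, mdist x (alpha i) < e.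
Proof.
move=> e0; have [|y [xy [i _ iy]]] := @cms_dense _ X _ _ (open_interior (ball x e)).
  by exists x; exact: nbhsx_ballx.
by exists i; have := interior_subset xy; rewrite ballEmdist /= iy.
Qed.

Lemma closed_dist (A : set X) x : closed A -> ~ A x ->
  exists N, forall y, A y -> 2 ^- N <= mdist x y.
Proof.
move=> clA Ax; have : nbhs x (~` A) by apply: open_nbhs_nbhs; split => //; exact: closed_openC.
move=> /nbhs_ballP [e /= e0 eA]; have [N Ne] := pow2V_lt e0.
exists N => y Ay; rewrite leNgt; apply/negP => lt; apply: (eA y) => //.
by rewrite ballEmdist /=; apply: lt_trans Ne.
Qed.

Lemma open_basic_ball b : open (basic_ball X b).
Proof.
rewrite openE => x; rewrite basic_ballE /= => h; apply/nbhs_ballP.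
exists (ratr (rat_enum (csnd b)) - mdist x (alpha (cfst b))) => /=.
  by rewrite subr_gt0.
move=> y; rewrite ballEmdist /= => xy.
have := metric_triangle y x (alpha (cfst b)); rewrite [mdist y x]metric_sym => ?; lra.
Qed.

(* The stages at which nothing is enumerated output [0], an empty ball. *)
Lemma sd_negative_name V : sd V -> exists e, forall p, exists q,
  computes e p q /\ \bigcup_i basic_ball X (q i) =
    [set x | exists t, V p t /\ mdist x (alpha (cfst t)) < 2 ^- csnd t].
Proof.
move=> [F [tF FP]].
pose Q p t := if F p t == 0%N
  then cpair (cfst (cfst t)) (pow2V_index (csnd (cfst t))) else 0%N.
have [e eP] : rtot Q.
  apply: rtot_if0; [exact: tF | rewrite /pow2V_index; by rt | by rt].
exists e => p; exists (Q p); split; first exact: eP.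
have Qball t : F p t = 0%N -> basic_ball X (Q p t) =
    [set x | mdist x (alpha (cfst (cfst t))) < 2 ^- csnd (cfst t)].
  move=> Ft; rewrite /Q Ft /= basic_ballE !(cfst_pair, csnd_pair).
  by rewrite ratr_pow2V_index.
apply/seteqP; split => x /= [t].
  move=> _; have [Ft|Ft] := eqVneq (F p t) 0%N.
    rewrite Qball // => xt; exists (cfst t); split => //.
    by apply/FP; exists (csnd t); rewrite cpair_fst_snd.
  rewrite /Q (negbTE Ft) basic_ballE rat_enumE /=.
  by rewrite subrr mul0r rmorph0 ltNge mdist_ge0.
move=> [/FP[k Fk] xt]; exists (cpair t k) => //.
by rewrite Qball //= cfst_pair.
Qed.

End ComputableMetric.

(** * Cantor schemes and perfect sets *)

Lemma countable_enum (T : Type) (x0 : T) (S : set T) : countable S ->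
  exists z : nat -> T, forall y, S y -> exists n, y = z n.
Proof.
move=> /countable_injP[f finj].
have /choice[z zP] : forall n, exists y,
    forall y', S y' -> f y' = n -> S y /\ f y = n.
  move=> n; have [[y [Sy fy]]|h] := pselect (exists y, S y /\ f y = n).
    by exists y.
  by exists x0 => y' Sy' fy'; exfalso; apply: h; exists y'.
exists z => y Sy; exists (f y); have [Sz fz] := zP _ _ Sy erefl.
by apply: finj; rewrite ?inE.
Qed.

(* The nodes of the infinite binary tree are numbered breadth first. *)
Definition child (i : bool) (s : nat) : nat := (s.*2 + i).+1.

(** The parent of a node is not a structural subterm; fuel exceeding the node number makes up for
    this. *)
Fixpoint tree_node (S : Type) (ch : S -> bool -> S) (root : S)
    (fuel s : nat) : S :=
  match fuel, s with
  | fuel'.+1, s'.+1 => ch (tree_node ch root fuel' s'./2) (odd s')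
  | _, _ => root
  end.

Lemma tree_node_fuel S (ch : S -> bool -> S) root k l s :
  (s < k)%N -> (s < l)%N -> tree_node ch root k s = tree_node ch root l s.
Proof.
elim: k l s => [|k IH] [|l] [|s] //=; rewrite !ltnS => sk sl.
by rewrite (IH l) // -divn2; apply: leq_ltn_trans (leq_div _ _) _.
Qed.

Lemma tree_recursion S (ch : S -> bool -> S) root : exists st : nat -> S,
  st 0%N = root /\ forall s i, st (child i s) = ch (st s) i.
Proof.
exists (fun s => tree_node ch root s.+1 s); split=> // s i.
rewrite (_ : tree_node _ _ _ (child i s) =
  ch (tree_node ch root (child i s) (s.*2 + i)./2) (odd (s.*2 + i))) //.
rewrite oddD odd_double addFb oddb addnC half_bit_double.
by rewrite (@tree_node_fuel _ _ _ _ s.+1) // /child; lia.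
Qed.

Section Schemes.
Variables (R : realType) (X : computableMetricSpace R).
Local Notation alpha := (cms_seq X).
Implicit Types (p f : baire) (A P : set X).

Lemma pow2V_double n : 2 ^- n = 2 ^- n.+1 + 2 ^- n.+1 :> R.
Proof. by rewrite exprS invfM mulrC -splitr. Qed.

(* [f] codes a Cantor scheme: the closed ball at the node [s] has centre
   [cfst (f s)] and radius [2 ^- csnd (f s)]. The balls are nested along the
   tree, siblings are disjoint, and no ball is visibly outside of the closed set
   named by [p]; all clauses are closed conditions on [f]. *)
Definition scheme p (b : nat) f : Prop :=
  [/\ f 0%N = b,
      forall s i, (csnd (f s) < csnd (f (child i s)))%N /\
        mdist (alpha (cfst (f s))) (alpha (cfst (f (child i s))))
          <= 2 ^- (csnd (f s)).+1,
      forall s i, 4 * 2 ^- csnd (f (child i s)) <=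
        mdist (alpha (cfst (f (child false s))))
              (alpha (cfst (f (child true s)))) &
      forall s i, ~ strict_in X (cfst (f s)) (csnd (f s)) (p i)].

Lemma strict_in_mono v m n b :
  (m <= n)%N -> strict_in X v m b -> strict_in X v n b.
Proof.
rewrite /strict_in => mn; apply: le_lt_trans; rewrite lerD2l.
by rewrite pow2V_le.
Qed.

Lemma fast_cauchy_cvg (u : nat -> X) : computable_polish X ->
  (forall m n, (n <= m)%N -> mdist (u m) (u n) <= 2 ^- n) ->
  exists x : X, u @ \oo --> x.
Proof.
move=> polX h; apply: polX; apply/cauchy_ballP => e e0.
have e20 : 0 < e / 2 by rewrite divr_gt0.
have [N NP] := pow2V_lt e20.
exists ([set y | mdist (u N) y < e / 2], [set y | mdist (u N) y < e / 2]).
  by split; exists N => // n /= Nn; rewrite metric_sym;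
    exact: le_lt_trans (h _ _ Nn) NP.
move=> [y y'] /= [h1 h2]; rewrite ballEmdist /=.
have := metric_triangle y (u N) y'; rewrite [mdist y (u N)]metric_sym => ?; lra.
Qed.

(** Cantor's diagonal argument: at level [n] the branch turns to a child whose ball misses [z n]. By
    completeness the balls along the branch shrink to a point. *)
Lemma scheme_uncountable p b f (z : nat -> X) : computable_polish X ->
  scheme p b f -> exists x, [/\ ~ (\bigcup_i basic_ball X (p i)) x,
    mdist x (alpha (cfst b)) <= 2 ^- csnd b & forall n, x <> z n].
Proof.
move=> polX [f0 nest sep inA].
pose a s := alpha (cfst (f s)); pose r s : R := 2 ^- csnd (f s).
pose br := fix br n := if n is n'.+1 then
  child `[< mdist (z n') (a (child false (br n'))) <= r (child false (br n')) >]
    (br n') else 0%N.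
have nested s i y : mdist y (a (child i s)) <= r (child i s) ->
    mdist y (a s) <= r s.
  move=> yc; have [ex dist] := nest s i.
  have := metric_triangle y (a (child i s)) (a s).
  rewrite [mdist (a (child i s)) _]metric_sym /r pow2V_double => tri.
  have : r (child i s) <= 2 ^- (csnd (f s)).+1 by rewrite pow2V_le.
  rewrite -/(a _) -/(a _) in dist; lra.
have exbr n : (n <= csnd (f (br n)))%N.
  elim: n => //= n IH; apply: leq_ltn_trans IH _.
  by have [] := nest (br n)
    `[< mdist (z n) (a (child false (br n))) <= r (child false (br n)) >].
have nestbr m n y : (n <= m)%N -> mdist y (a (br m)) <= r (br m) ->
    mdist y (a (br n)) <= r (br n).
  elim: m => [|m IH]; first by rewrite leqn0 => /eqP->.
  rewrite leq_eqVlt => /orP[/eqP-> //|nm h]; apply: IH => //.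
  exact: nested h.
have rbr n : r (br n) <= 2 ^- n by rewrite pow2V_le.
have cbr m n : (n <= m)%N -> mdist (a (br m)) (a (br n)) <= r (br n).
  by move=> nm; apply: (nestbr m) => //; rewrite mdistxx ltW // pow2V_gt0.
have [|x xP] := @fast_cauchy_cvg (fun n => a (br n)) polX.
  by move=> m n nm; apply: le_trans (cbr m n nm) (rbr n).
have xbr n : mdist x (a (br n)) <= r (br n).
  by apply: (cvg_dist_le (N := n) xP) => m; exact: cbr.
exists x; split.
- move=> [i _ /(@basic_ball_strict_in _ _ _ _ (fun k => cfst (f (br k))))].
  case=> [k|k kP].
    by rewrite metric_sym; apply: le_trans (xbr k) (rbr k).
  (* The radius at level [k] is at most [2 ^- k], so a formal inclusion found at precision [k]
     persists at the precision of the node. *)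
  by apply: (inA (br k) i); apply: strict_in_mono kP.
- by have := xbr 0%N; rewrite /= /a /r f0.
- move=> n xz; have := xbr n.+1; rewrite /=; case: asboolP => [zin|//].
    (* A point in both sibling balls would bound the distance of the centres by the sum of the
       radii, whereas it is at least four times each radius. *)
    move=> xin; rewrite -xz in zin.
    have := sep (br n) false; have := sep (br n) true.
    have := metric_triangle (a (child false (br n))) x (a (child true (br n))).
    rewrite [mdist (a (child false _)) x]metric_sym.
    rewrite /a /r in zin xin *.
    have := pow2V_gt0 R (csnd (f (child true (br n)))).
    have := pow2V_gt0 R (csnd (f (child false (br n)))).
    by clear f0 xz; move=> *; lra.
  by rewrite -xz.
Qed.

(** Each node carries a point of [P] within half the radius of its centre. As that point is not
    isolated, a second point of [P] lies in the remaining room, and small balls around the two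
    become the children. *)
Lemma perfect_scheme p b P x : perfect_set P -> P x ->
  (forall y, P y -> ~ (\bigcup_i basic_ball X (p i)) y) ->
  mdist x (alpha (cfst b)) < 2 ^- (csnd b).+1 -> exists f, scheme p b f.
Proof.
move=> [clP limP] Px PA xb.
pose inv (st : X * nat) := P st.1 /\
  mdist st.1 (alpha (cfst st.2)) < 2 ^- (csnd st.2).+1.
have step st : exists ch : bool -> X * nat, inv st ->
    [/\ forall i, inv (ch i),
       forall i, (csnd st.2 < csnd (ch i).2)%N /\
         mdist (alpha (cfst st.2)) (alpha (cfst (ch i).2))
           <= 2 ^- (csnd st.2).+1 &
       forall i, 4 * 2 ^- csnd (ch i).2 <=
         mdist (alpha (cfst (ch false).2)) (alpha (cfst (ch true).2))].
  have [[Py yst]|] := pselect (inv st); last by exists (fun=> st).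
  move: st Py yst => [y c] /= Py yst.
  set h := 2 ^- (csnd c).+1 in yst *.
  have : limit_point P y by rewrite limP.
  have d0 : 0 < h - mdist y (alpha (cfst c)) by rewrite subr_gt0.
  move=> /(_ _ (nbhsx_ballx y _ d0)) [y' [yy' Py' yb']].
  rewrite ballEmdist /= in yb'.
  have y'st : mdist y' (alpha (cfst c)) < h.
    have := metric_triangle y' y (alpha (cfst c)).
    by rewrite [mdist y' y]metric_sym => ?; lra.
  have dy0 : 0 < mdist y y' by rewrite mdist_gt0 eq_sym.
  have y'd0 : 0 < h - mdist y' (alpha (cfst c)) by rewrite subr_gt0.
  have [n1 n1P] := pow2V_lt d0; have [n2 n2P] := pow2V_lt y'd0.
  (* A fifth: four parts for the separation of the centres, one for the two errors [2 ^- n.+1] in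
     placing them. *)
  have dy50 : 0 < mdist y y' / 5 by rewrite divr_gt0.
  have [n3 n3P] := pow2V_lt dy50.
  pose n := maxn (maxn n1 n2) (maxn n3 (csnd c).+1).
  have cn : (csnd c < n)%N by rewrite !leq_max leqnn !orbT.
  have nn1 : 2 ^- n <= 2 ^- n1 :> R by rewrite pow2V_le !leq_max leqnn ?orbT.
  have nn2 : 2 ^- n <= 2 ^- n2 :> R by rewrite pow2V_le !leq_max leqnn ?orbT.
  have nn3 : 2 ^- n <= 2 ^- n3 :> R by rewrite pow2V_le !leq_max leqnn ?orbT.
  have n0 : 0 < 2 ^- n.+1 :> R by exact: pow2V_gt0.
  have n2E := pow2V_double n.
  have [v vP] := dense_near y n0; have [v' v'P] := dense_near y' n0.
  exists (fun i => if i then (y', cpair v' n) else (y, cpair v n)) => _; split.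
  - by case; rewrite /inv /= !(cfst_pair, csnd_pair).
  - case; rewrite /= !(cfst_pair, csnd_pair) -/h.
      split=> //.
      have := metric_triangle (alpha (cfst c)) y' (alpha v').
      by rewrite [mdist _ y']metric_sym => ?; lra.
    split=> //.
    have := metric_triangle (alpha (cfst c)) y (alpha v).
    by rewrite [mdist _ y]metric_sym => ?; lra.
  - have : 4 * 2 ^- n <= mdist (alpha v) (alpha v').
      have := metric_triangle y (alpha v) y'.
      have := metric_triangle (alpha v) (alpha v') y'.
      by rewrite [mdist (alpha v') y']metric_sym => ? ?; lra.
    by move=> ?; case; rewrite /= !(cfst_pair, csnd_pair).
have [ch chP] := choice step.
have [st [st0 stS]] := tree_recursion ch (x, b).
have inv0 : inv (x, b) by [].
have invst s : inv (st s).
  elim/ltn_ind: s => -[|s] IH; first by rewrite st0.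
  have -> : s.+1 = child (odd s) s./2 by rewrite /child addnC odd_double_half.
  rewrite stS; have := IH s./2; rewrite ltnS -divn2 => /(_ (leq_div _ _)) /chP.
  by move=> [].
exists (fun s => (st s).2); split.
- by rewrite st0.
- by move=> s i; rewrite stS; have [_ + _] := chP _ (invst s); apply.
- by move=> s i; rewrite !stS; have [_ _] := chP _ (invst s); apply.
- move=> s i strict; have [Ps ds] := invst s; apply: (PA _ Ps).
  exists i => //; apply: (strict_in_sub strict); rewrite metric_sym.
  by have := pow2V_double (csnd (st s).2); have := pow2V_gt0 R (csnd (st s).2).+1; lra.
Qed.

(** Since [P] is closed it has a negative name, so a small ball around [x] carries a scheme, and
    diagonalising along it defeats any enumeration. *)
Lemma perfect_not_countable P x e : computable_polish X ->
  perfect_set P -> P x -> 0 < e ->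
  ~ countable (P `&` [set y | mdist x y < e]).
Proof.
move=> polX perfP Px e0 cnt.
have e20 : 0 < e / 2 by rewrite divr_gt0.
have [N NP] := pow2V_lt e20; have NE := pow2V_double N.
have [c cP] := dense_near x (pow2V_gt0 R N.+1).
have [clP _] := perfP.
have [p pP] := negative_name_surjective (exist closed P clP).
rewrite /negative_name /= in pP.
have [z zP] := countable_enum x cnt.
have [||f fP] := @perfect_scheme p (cpair c N) P x perfP Px.
- by move=> y; rewrite pP.
- by rewrite cfst_pair csnd_pair.
have [y [yA yc yz]] := scheme_uncountable z polX fP.
have Py : P y by rewrite pP.
case: (zP y) => [|n /yz //]; split => //=.
rewrite cfst_pair csnd_pair in yc.
have := metric_triangle x (alpha c) y; rewrite [mdist (alpha c) y]metric_sym => ?.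
have := pow2V_gt0 R N.+1 => ?; lra.
Qed.

End Schemes.

(** * Interleaved oracles and the topology of Baire space *)

Lemma rtot_double F : rtot F -> rtot (fun p n => (F p n).*2).
Proof.
move=> tF; apply: (@rtot_ext (fun p n => 2 * F p n)%N); last by rt.
by move=> p n; rewrite mul2n.
Qed.

Definition evens (o : baire) : baire := fun i => o i.*2.
Definition odds (o : baire) : baire := fun i => o i.*2.+1.

Lemma evens_interleave p q : evens (interleave p q) = p.
Proof.
by apply/funext => i; rewrite /evens /interleave odd_double doubleK.
Qed.

Lemma odds_interleave p q : odds (interleave p q) = q.
Proof.
apply/funext => i; rewrite /odds /interleave /= odd_double /=.
by rewrite uphalf_double.
Qed.

Lemma rtot_evens F : rtot F -> rtot (fun p n => evens p (F p n)).
Proof. by move=> tF; apply/rtot_oracle/rtot_double. Qed.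

Lemma rtot_odds F : rtot F -> rtot (fun p n => odds p (F p n)).
Proof. by move=> tF; apply/rtot_oracle/rtot_succ/rtot_double. Qed.

Lemma rtot_app2 (f : baire -> nat -> baire) F G :
  rtot (fun p t => f p (cfst t) (csnd t)) -> rtot F -> rtot G ->
  rtot (fun p n => f p (F p n) (G p n)).
Proof.
move=> tf tF tG; apply: rtot_ext (rtot_comp tf (rtot_pair tF tG)) => p n.
by rewrite cfst_pair csnd_pair.
Qed.

#[local] Hint Resolve rtot_double rtot_evens rtot_odds : rtot.

Lemma closed_name (R : realType) (X : computableMetricSpace R) (p : baire) :
  closed (~` (\bigcup_i basic_ball X (p i))).
Proof.
by apply: open_closedC; apply: bigcup_open => i _; exact: open_basic_ball.
Qed.

Section BaireTopology.
Variable R : realType.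
Local Notation B := (baire_cms R).
Implicit Types x y : B.

Lemma baire_mdist_lt x y n : mdist x y < 2 ^- n <->
  forall k, (k < n.+1)%N -> (x : baire) k = (y : baire) k.
Proof.
split=> [lt k kn|eqs].
  apply: contrapT => /(@baire_dist_ge R) /le_lt_trans /(_ lt).
  by rewrite ltNge pow2V_le -ltnS kn.
apply: le_lt_trans (_ : 2 ^- n.+1 < _); first exact/baire_dist_le.
by rewrite ltNge pow2V_le -ltnNge.
Qed.

Lemma baire_nbhsP x (U : set B) : nbhs x U <-> exists n, forall y,
  (forall k, (k < n)%N -> (y : baire) k = (x : baire) k) -> U y.
Proof.
split=> [/nbhs_ballP [e /= e0 eU]|[n nU]].
  have [n ne] := pow2V_lt e0; exists n.+1 => y xy; apply: eU.
  rewrite ballEmdist /=; apply: lt_trans ne; apply/baire_mdist_lt => k kn.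
  by rewrite xy.
apply/nbhs_ballP; exists (2 ^- n); first exact: pow2V_gt0.
move=> y; rewrite ballEmdist /= => /baire_mdist_lt xy; apply: nU => k kn.
by rewrite xy // ltnW.
Qed.

(** Parameter and point form one interleaved oracle; the cylinders provided by the use principle are
    open balls. *)
Lemma sd_baire_name W : sd W -> exists e, forall p, exists q, computes e p q /\
  ~` (\bigcup_i basic_ball B (q i)) = [set x | ~ W (interleave p x) 0%N].
Proof.
move=> /sd_cylinders[V [sV VP]].
have [e eP] : exists e, forall p, exists q, computes e p q /\
    \bigcup_i basic_ball B (q i) = [set x | exists t,
      V p (cpair 0 t) /\ mdist x (cms_seq B (cfst t)) < 2 ^- csnd t].
  apply: (@sd_negative_name R B (fun p t => V p (cpair 0 t))).
  by apply: sd_sub => //; rt.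
exists e => p; have [q [qe qP]] := eP p; exists q; split => //.
rewrite qP; apply/seteqP; split => x /= nW.
  by rewrite VP => -[t [Vt xt]]; apply: nW; exists t; split => //; apply/baire_mdist_lt.
by move=> [t [Vt /baire_mdist_lt xt]]; apply: nW; apply/VP; exists t.
Qed.

Lemma perfect_setP (T : topologicalType) (A : set T) :
  closed A -> A `<=` limit_point A -> perfect_set A.
Proof.
move=> clA sub; split=> //; apply/seteqP; split=> // x xA; apply: clA => U.
by move=> /xA [y [_ Ay Uy]]; exists y.
Qed.

Definition zeros (b : nat) : baire := fun k => if k is 0%N then b else 0%N.

(** The marker is a term of the dense sequence, with a computable index. Hence its exclusion from a
    named closed set is semi-decidable. *)
Lemma zeros_seq b : baire_seq (cpair b 0) = zeros b.
Proof.
apply/funext => -[|k]; rewrite /baire_seq /=; first exact: cfst_pair.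
rewrite -iterS iterSr csnd_pair.
have -> : iter k csnd 0%N = 0%N by elim: k => //= k ->.
by [].
Qed.

End BaireTopology.

(** * From Polish spaces to Baire space *)

Section FromPolish.
Variables (R : realType) (X : computableMetricSpace R).
Local Notation alpha := (cms_seq X).
Local Notation B := (baire_cms R).
Implicit Types (p f g : baire) (x y : baire).

(** Every clause of [scheme] fails in a Sigma_1 way: the order and equality clauses are decidable,
    and the negated distance clauses are strict inequalities. *)
Lemma sd_not_scheme (f : baire -> nat -> baire) (b : baire -> nat -> nat) :
  rtot b -> rtot (fun o t => f o (cfst t) (csnd t)) ->
  sd (fun o t => ~ scheme X (evens o) (b o t) (f o t)).
Proof.
move=> tb tf.
pose bad o t s i :=
  ((csnd (f o t (child i s)) <= csnd (f o t s))%N \/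
   1%:R * 2 ^- (csnd (f o t s)).+1 <
     mdist (alpha (cfst (f o t s))) (alpha (cfst (f o t (child i s)))) ) \/
  mdist (alpha (cfst (f o t (child false s))))
    (alpha (cfst (f o t (child true s)))) < 4 * 2 ^- csnd (f o t (child i s)).
apply: (@sd_ext (fun o t => ((f o t 0%N < b o t)%N \/ (b o t < f o t 0%N)%N) \/
  exists s, (bad o t s false \/ bad o t s true) \/
    exists i, strict_in X (cfst (f o t s)) (csnd (f o t s)) (evens o i))).
  move=> o t; split.
    move=> h [f0 nest sep inA]; case: h => [[]|]; rewrite ?f0 ?ltnn //.
    move=> [s [h|[i]]]; last exact: inA.
    have [i bads] : exists i, bad o t s i by case: h; eexists; eassumption.
    have [lt le] := nest s i; have sp := sep s i.
    case: bads => [[|]|]; first by rewrite leqNgt lt.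
      by rewrite mul1r ltNge le.
    by rewrite ltNge sp.
  move=> nsch; apply: contrapT => h; apply: nsch; split.
  - have [lt|gt|//] := ltngtP (f o t 0%N) (b o t); case: h; left.
      by left.
    by right.
  - move=> s i; have nb : ~ bad o t s i.
      by move=> bs; case: h; right; exists s; left; case: i bs => ?; [right|left].
    split; first by rewrite ltnNge; apply/negP => ?; case: nb; left; left.
    by rewrite -[leRHS]mul1r leNgt; apply/negP => ?; case: nb; left; right.
  - move=> s i; rewrite leNgt; apply/negP => lt; case: h; right; exists s.
    by left; case: i lt => ?; [right|left]; right.
  - by move=> s i st; case: h; right; exists s; right; exists i.
have tb1 : rtot (fun o t => b o (cfst t)) by apply: (rtot_comp tb); rt.
have tf2 F G := @rtot_app2 f F G tf.
have tc i F : rtot F -> rtot (fun p n => child i (F p n)).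
  by move=> tF; rewrite /child; rt.
apply: sd_or.
  by apply: sd_or; apply: sd_leq; try (apply: rtot_succ); try exact: tb;
    apply: tf2; rt.
apply: sd_ex.
have sb i : sd (fun o t => bad o (cfst t) (csnd t) i).
  have t1 : rtot (fun o t => f o (cfst t) (csnd t)) by apply: tf2; rt.
  have t2 j : rtot (fun o t => f o (cfst t) (child j (csnd t))).
    by apply: tf2; [|apply: tc]; rt.
  apply: sd_or; first apply: sd_or.
  - by apply: sd_leq; apply: rtot_snd.
  - by apply: sd_dist_gt_pow2V; rt.
  - by apply: sd_dist_lt_pow2V; rt.
apply: sd_or; first by apply: sd_or; exact: sb.
apply: sd_ex; apply: sd_strict_in; last by rt.
- by apply: rtot_fst; apply: tf2; rt.
- by apply: rtot_snd; apply: tf2; rt.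
Qed.

(* The complement of the closed set [marked] to be analysed in Baire space. Among
   the [x] with [x 0 = b] that set has the marker [zeros b] and, if there is a
   scheme [f] for [b], points [b 0^n a t] with [a > 0] that approximate the marker
   and whose tail [t] codes [f] together with an arbitrary sequence. *)
Definition outside_marked p x : Prop := exists n,
  ((forall k, (k < n)%N -> x k.+1 = 0%N) /\ (0 < x n.+1)%N) /\
  ~ scheme X p (x 0%N) (fun k => cfst (x (n.+2 + k)%N)).

Lemma sd_outside_marked : sd (fun o _ => outside_marked (evens o) (odds o)).
Proof.
apply: sd_ex; apply: sd_and; first apply: sd_and.
- apply: sd_ball; first by rt.
  by apply: sd_eq; rt.
- by apply: sd_leq; rt.
- apply: (sd_not_scheme (f := fun o t k => cfst (odds o ((csnd t).+2 + k)%N))).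
    by rt.
  by rt.
Qed.

Definition marked p : set B := [set x | ~ outside_marked p x].

(** The point [b 0^n 1] followed by the pairs of [f] and [g]. It agrees with the marker on [n.+1]
    terms, and the free component [g] makes room for uncountably many such points. *)
Definition marked_point b n f g : baire := fun k =>
  if k is k'.+1 then if (k' < n)%N then 0%N else if k' == n then 1%N
  else cpair (f (k' - n.+1)%N) (g (k' - n.+1)%N) else b.

Lemma marked_point_tail b n f g k :
  marked_point b n f g (n.+2 + k)%N = cpair (f k) (g k).
Proof.
rewrite /marked_point addSn /= ltnNge ltnW ?ltnS ?leq_addr //=.
by rewrite gtn_eqF ?ltnS ?leq_addr // addKn.
Qed.

Lemma markedE p x n : (forall k, (k < n)%N -> x k.+1 = 0%N) ->
  (0 < x n.+1)%N ->
  marked p x <-> scheme X p (x 0%N) (fun k => cfst (x (n.+2 + k)%N)).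
Proof.
move=> x0 xn; split=> [mx|sch [m [[x0' xm] nsch]]].
  by apply: contrapT => nsch; apply: mx; exists n.
suff mn : m = n by apply: nsch; rewrite mn.
have [lt|lt|//] := ltngtP m n; first by rewrite x0 in xm.
by rewrite x0' in xn.
Qed.

Lemma marked_point_in p b n f g :
  scheme X p b f -> marked p (marked_point b n f g).
Proof.
move=> sch; apply/(@markedE _ _ n).
- by move=> k kn; rewrite /= kn.
- by rewrite /= ltnn eqxx.
rewrite (_ : (fun k => _) = f) //; apply/funext => k.
by rewrite marked_point_tail cfst_pair.
Qed.

Lemma not_zeros x : x <> zeros (x 0%N) -> exists n,
  (forall k, (k < n)%N -> x k.+1 = 0%N) /\ (0 < x n.+1)%N.
Proof.
move=> xz; have ex : exists n, (0 < x n.+1)%N.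
  apply: contrapT => h; apply: xz; apply/funext => -[|k] //=.
  by apply/eqP; rewrite eqn0Ngt; apply/negP => ?; apply: h; exists k.
have [n xn nmin] := ex_minnP ex; exists n; split => // k kn.
by apply/eqP; rewrite eqn0Ngt; apply: contraTN kn => /nmin; rewrite -leqNgt.
Qed.

Lemma marked_scheme p x : marked p x -> x <> zeros (x 0%N) ->
  exists f, scheme X p (x 0%N) f.
Proof.
by move=> mx /not_zeros[n [x0 xn]]; eexists; apply/(markedE p x0 xn).
Qed.

Definition marked_kernel p : set B :=
  marked p `&` [set x : B | exists f, scheme X p ((x : baire) 0%N) f].

(** An explicit kernel shows that [marked p] is in the domain of the problem. The points removed are
    markers without a scheme, at most one for each first term. *)
Lemma marked_kernelP p : closed (marked p) ->
  perfect_kernel (marked p) (marked_kernel p).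
Proof.
move=> clm; split; last first.
- apply/countable_injP; exists (fun x : B => (x : baire) 0%N).
  have E x : marked p x -> ~ marked_kernel p x -> x = zeros (x 0%N).
    by move=> mx kx; apply: contrapT => /(marked_scheme mx) ?; apply: kx.
  move=> x y /set_mem[mx kx] /set_mem[my ky] xy.
  by rewrite (E _ mx kx) (E _ my ky) xy.
- by move=> x [].
apply: perfect_setP.
  apply: closedI => //; rewrite -[X in closed X]setCK; apply: open_closedC.
  rewrite openE => x nx; apply/baire_nbhsP; exists 1%N => y xy /=.
  by rewrite xy.
move=> x [mx [f sch]] U /baire_nbhsP[m mU].
have [xz|] := pselect ((x : baire) = zeros ((x : baire) 0%N)).
  exists (marked_point ((x : baire) 0%N) m f f); split.
  - apply/eqP => /(congr1 (fun y : baire => y m.+1)); rewrite xz.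
    by rewrite /= ltnn eqxx.
  - by split; [exact: marked_point_in | exists f].
  - by apply: mU => -[|k] km //; rewrite xz /= ltnW.
move=> /not_zeros[n [x0 xn]].
(* Away from the marker, changing the free component at the late position [j] gives a nearby point
   with the same scheme. *)
pose j := (n.+2 + m)%N.
pose y : baire := fun k => if k == j
  then cpair (cfst ((x : baire) k)) (csnd ((x : baire) k)).+1 else (x : baire) k.
have yx k : (k < j)%N -> y k = (x : baire) k by move=> kj; rewrite /y ltn_eqF.
exists y; split.
- apply/eqP => /(congr1 (fun y : baire => csnd (y j))).
  by rewrite /y eqxx csnd_pair => /eqP; rewrite eqn_leq ltnn.
- split; last by exists f; rewrite /= yx.
  apply/(@markedE _ _ n).
  + by move=> k kn; rewrite yx ?x0 // /j; lia.
  + by rewrite yx // /j; lia.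
  have <- : (fun k => cfst ((x : baire) (n.+2 + k)%N)) =
      (fun k => cfst (y (n.+2 + k)%N)).
    by apply/funext => k; rewrite /y; case: eqP => // _; rewrite cfst_pair.
  by rewrite yx //; apply/(markedE p x0 xn).
- by apply: mU => k km; rewrite yx // /j; lia.
Qed.

(** If the marker survives, another kernel point with first term [b] provides a scheme. Conversely,
    if it does not, a whole ball around it misses [P] although a scheme would put uncountably many
    marked points there. *)
Lemma marked_kernel_zeros p (P : set B) b : perfect_kernel (marked p) P ->
  P (zeros b) <-> exists f, scheme X p b f.
Proof.
move=> [[clP limP] Pm cnt]; split=> [Pb|[f sch]].
  have : limit_point P (zeros b) by rewrite limP.
  case/(_ [set y : B | (y : baire) 0%N = b]) => [|y [yb Py /= y0]].
    by apply/baire_nbhsP; exists 1%N => y h /=; rewrite h.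
  rewrite -[b]y0; apply: marked_scheme; first exact: Pm.
  by rewrite y0; apply/eqP.
apply: contrapT => nP; have [N NP] := closed_dist clP nP.
have [z zP] := countable_enum (zeros b : B) cnt.
(* The free component is chosen to differ from that of [z k] at position [k]. *)
pose g k := (csnd ((z k : baire) (N.+2 + k)%N)).+1.
case: (zP (marked_point b N f g)) => [|k].
  split; first exact: marked_point_in.
  move=> /NP; rewrite leNgt => /negP; apply; apply/baire_mdist_lt => -[|k] //.
  by rewrite ltnS => kN; rewrite /= kN.
move=> /(congr1 (fun y : baire => csnd (y (N.+2 + k)%N))).
by rewrite marked_point_tail csnd_pair /g => /eqP; rewrite eqn_leq ltnn.
Qed.

Lemma PK_le_baire : computable_polish X ->
  weihrauch_le (PK X) (PK B).
Proof.
move=> polX.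
have [phi phiP] := sd_baire_name R sd_outside_marked.
(* The oracle is [interleave p q], so [odds o] names the kernel in Baire space. The marker belongs
   to the ball of twice the radius, since [perfect_scheme] wants a point within half the radius. *)
pose V (o : baire) t := (0 < csnd t)%N /\ exists i, exists n,
  strict_in B (cpair (cpair (cfst t) (csnd t).-1) 0) n (odds o i).
have [psi psiP] : exists e, forall p, exists q, computes e p q /\
    \bigcup_i basic_ball X (q i) =
    [set x | exists t, V p t /\ mdist x (alpha (cfst t)) < 2 ^- csnd t].
  apply: sd_negative_name; apply: sd_and; first by apply: sd_leq; rt.
  by do 2 apply: sd_ex; apply: sd_strict_in; rt.
exists phi, psi => A p [K KA] pA.
have [p' [p'c p'E]] := phiP p.
have mE : ~` (\bigcup_i basic_ball B (p' i)) = marked p.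
  rewrite p'E; apply/seteqP; split=> x /=;
  by rewrite /marked /= evens_interleave odds_interleave.
have clm : closed (marked p) by rewrite -mE; exact: closed_name.
exists p', (exist _ (marked p) clm); split => //.
- have kP := marked_kernelP clm; have [[clk _] _ _] := kP.
  by exists (exist _ (marked_kernel p) clk).
move=> [P clP] q kP qP.
have {}kP : perfect_kernel (marked p) P := kP.
have {}qP : P = ~` (\bigcup_i basic_ball B (q i)) := qP.
have [q' [q'c q'E]] := psiP (interleave p q).
exists q', K; split => //; rewrite /= /negative_name q'E.
have VE t : V (interleave p q) t <-> (0 < csnd t)%N /\
    ~ exists f, scheme X p (cpair (cfst t) (csnd t).-1) f.
  rewrite -(marked_kernel_zeros _ kP) qP -zeros_seq /V odds_interleave /=.
  split=> -[t0 h]; split => //.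
    move=> nz; apply: nz; move: h => [i [n h]]; exists i => //.
    apply: (strict_in_sub h); rewrite [X in X <= _](_ : _ = 0) ?ltW ?pow2V_gt0 //.
    exact: mdistxx.
  move: h => /contrapT[i _].
  (* The marker is a point of the dense sequence, so a constant sequence approximates it. *)
  move=> /(@basic_ball_strict_in _ _ _ _
    (fun=> cpair (cpair (cfst t) (csnd t).-1) 0)).
  case=> [k|n h]; last by exists i, n.
  by rewrite [X in X <= _](_ : _ = 0) ?ltW ?pow2V_gt0 //; exact: mdistxx.
case: KA => perfK KA cnt; have [clK _] := perfK.
apply/seteqP; split=> x /=.
  move=> Kx [t [/VE[t0 nsch] xt]]; apply: nsch.
  apply: (perfect_scheme perfK Kx).
    by move=> y /KA; rewrite pA.
  by rewrite cfst_pair csnd_pair prednK.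
move=> nV; apply: contrapT => Kx; apply: nV.
have [N NP] := closed_dist clK Kx.
have NE := pow2V_double R N; have NE' := pow2V_double R N.+1.
have N0 := pow2V_gt0 R N.+2.
(* With index [N.+2] the scheme ball has radius [2 ^- N.+1], so all its points are closer to [x]
   than [2 ^- N] and lie outside [K]. A scheme would contradict the countability of the rest. *)
have [c cP] := dense_near x N0.
exists (cpair c N.+2); rewrite !(cfst_pair, csnd_pair); split => //.
apply/VE; rewrite !(cfst_pair, csnd_pair); split => // -[f sch].
have [z zP] := countable_enum x cnt.
have [y [yA yc yz]] := scheme_uncountable z polX sch.
case: (zP y) => [|n /yz //]; split; first by rewrite pA.
move=> /NP; rewrite leNgt => /negP; apply; rewrite !(cfst_pair, csnd_pair) /= in yc.
have := metric_triangle x (alpha c) y; rewrite [mdist (alpha c) y]metric_sym => ?.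
lra.
Qed.

End FromPolish.

(** * From Baire space to rich Polish spaces *)

Lemma enum_countable (T : Type) (S : set T) (z : nat -> T) :
  (forall y, S y -> exists n, y = z n) -> countable S.
Proof.
move=> zP; have /choice[f fP] : forall y, exists n, S y -> y = z n.
  move=> y; have [/zP[n ->]|] := pselect (S y); first by exists n.
  by exists 0%N.
apply/countable_injP; exists f => x y /set_mem Sx /set_mem Sy fxy.
by rewrite (fP x Sx) (fP y Sy) fxy.
Qed.

(** * The embedding of Baire space into Cantor space *)

Section Embedding.
Local Open Scope nat_scope.
Implicit Types (x y : baire) (u : nat -> bool).

(** The length of the code of the first [n] terms, which is the position just after the [n]-th
    one. *)
Definition steps x (n : nat) : nat := prec 0 (fun i r => r + (x i).+1) n.

(* [x] is coded by the sequence [0^(x 0) 1 0^(x 1) 1 ...]; the sequences that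
   are not codes are those with finitely many ones. *)
Definition embed x : nat -> bool := fun k => `[< exists n, steps x n.+1 = k.+1 >].

Lemma stepsS x n : steps x n.+1 = steps x n + (x n).+1.
Proof. by []. Qed.

Lemma steps_prefix x y n : (forall k, k < n -> x k = y k) ->
  forall k, k <= n -> steps x k = steps y k.
Proof.
move=> xy; elim=> // k IH kn.
by rewrite !stepsS IH ?xy // ltnW.
Qed.

Lemma steps_lt x m n : (steps x m < steps x n) = (m < n).
Proof.
have mono : {homo steps x : b c / b < c}.
  move=> b; elim=> // c IH; rewrite ltnS leq_eqVlt stepsS => /orP[/eqP->|/IH h].
    by lia.
  by lia.
apply/idP/idP => [lt|/mono //].
rewrite ltnNge; apply/negP; rewrite leq_eqVlt => /orP[/eqP nm|/mono nm].
  by rewrite nm ltnn in lt.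
by rewrite ltnNge ltnW in lt.
Qed.

Lemma steps_le x m n : (steps x m <= steps x n) = (m <= n).
Proof. by rewrite leqNgt steps_lt -leqNgt. Qed.

Lemma steps_ge x n : n <= steps x n.
Proof. by elim: n => // n /leq_ltn_trans; apply; rewrite steps_lt. Qed.

Lemma embed_prefix x y n : (forall k, k < n -> x k = y k) ->
  forall k, k < steps x n -> embed x k = embed y k.
Proof.
move=> xy k kn; have xyn := steps_prefix xy.
apply/asbool_equiv_eq; split=> -[m mk]; exists m; rewrite -mk.
  by rewrite xyn // -(steps_le x) mk.
by rewrite xyn // -(steps_le y) mk -xyn.
Qed.

Lemma embed_inj_prefix x y n :
  (forall k, k < steps x n -> embed y k = embed x k) ->
  forall k, k < n -> x k = y k.
Proof.
(* If two codes are at the same position, a one of [embed w] where the next one of [embed z] stands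
   bounds [w m] by [z m]. *)
have key z w m : steps z m = steps w m -> embed w (steps z m + z m) ->
    w m <= z m.
  move=> zw /asboolP[l lP].
  have ml : m <= l by rewrite -ltnS -(steps_lt w) lP -zw; lia.
  have : steps w m.+1 <= steps w l.+1 by rewrite steps_le.
  by rewrite lP stepsS zw; lia.
have emb z m : embed z (steps z m + z m).
  by apply/asboolP; exists m; rewrite stepsS addnS.
elim: n => // n IH h k; rewrite ltnS leq_eqVlt => /orP[/eqP->|]; last first.
  apply: IH => j jn; apply: h; apply: leq_trans jn _.
  by rewrite steps_le.
have {}IH : forall k, k < n -> x k = y k.
  by apply: IH => j jn; apply: h; apply: leq_trans jn _; rewrite steps_le.
have xyn := steps_prefix IH (leqnn n).
have sS : steps x n.+1 = (steps x n + x n).+1 by rewrite stepsS addnS.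
(* This direction comes first: it keeps the position used for the converse below [steps x n.+1],
   where [h] applies. *)
have yx : y n <= x n by apply: key => //; rewrite h ?emb // sS.
apply/eqP; rewrite eqn_leq yx andbT.
by apply: key; rewrite -?h ?emb // sS -xyn; lia.
Qed.

(** The terms of [x] are the lengths of the blocks of zeros between successive ones, and [s n] is
    the position after the [n]-th one. *)
Lemma embed_surj u : (forall k, exists j, k <= j /\ u j) ->
  exists x, embed x = u.
Proof.
move=> inf.
have /choice[next nextP] : forall k, exists j, [/\ k <= j, u j &
    forall i, k <= i -> u i -> j <= i].
  move=> k; have ex : exists j, (k <= j) && u j.
    by have [j [kj uj]] := inf k; exists j; rewrite kj.
  have [j /andP[kj uj] jmin] := ex_minnP ex; exists j; split => // i ki ui.
  by apply: jmin; rewrite ki.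
pose s n := iter n (fun k => (next k).+1) 0.
pose x : baire := fun n => next (s n) - s n.
have sE n : steps x n = s n.
  elim: n => // n IH; rewrite stepsS IH /x addnS subnKC //.
  by have [] := nextP (s n).
exists x; apply/funext => k; apply/asboolP/idP => [[n]|uk].
  by rewrite sE /= => -[<-]; have [] := nextP (s n).
have ex : exists n, k < steps x n by exists k.+1; exact: steps_ge.
have [[|n] kn nmin] := ex_minnP ex; first by [].
exists n; apply/eqP; rewrite eqn_leq kn andbT sE /= ltnS.
have [_ _] := nextP (s n); apply => //; rewrite -sE leqNgt; apply/negP => /nmin.
by rewrite ltnn.
Qed.

Lemma countable_finite_support :
  countable [set u | exists k, forall j, k <= j -> u j = false].
Proof.
apply: (@enum_countable _ _ (fun s i => odd (s %/ 2 ^ i))) => u [k kP].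
have [s sk su] := bits_prefix u k; exists s; apply/funext => i.
have [ik|ki] := ltnP i k; first by rewrite su.
rewrite kP // divn_small //; apply: leq_trans sk _.
by rewrite leq_exp2l.
Qed.

Lemma embed_cases u : (exists k, forall j, k <= j -> u j = false) \/
  exists x, u = embed x.
Proof.
have [h|h] := pselect (forall k, exists j, k <= j /\ u j).
  by have [x <-] := embed_surj h; right; exists x.
left; apply: contrapT => nk; apply: h => k; apply: contrapT => nj; apply: nk.
exists k => j kj; apply/negbTE/negP => uj; apply: nj; by exists j.
Qed.

Lemma rtot_steps (x : baire -> nat -> baire) F :
  rtot (fun o t => x o (cfst t) (csnd t)) -> rtot F ->
  rtot (fun o t => steps (x o t) (F o t)).
Proof.
move=> tx tF.
apply: (rtot_prec (b := fun o t i r => r + (x o t i).+1)) => //.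
  exact: rtot_const.
have ? : rtot (fun p t => x p (cfst t) (cfst (csnd t))) by apply: rtot_app2; rt.
by rt.
Qed.

(** Since [steps x n.+1] is at least [n.+1], only finitely many [n] can witness a one at a given
    position, so both values can be recognised. *)
Lemma sd_eq_embed (x : baire -> nat -> baire) F G :
  rtot (fun o t => x o (cfst t) (csnd t)) -> rtot F -> rtot G ->
  sd (fun o t => F o t = embed (x o t) (G o t)).
Proof.
move=> tx tF tG.
apply: (@sd_ext (fun o t =>
  (F o t = 1 /\ exists n, steps (x o t) n.+1 = (G o t).+1) \/
  (F o t = 0 /\ forall n, n < (G o t).+1 ->
     (steps (x o t) n.+1 < (G o t).+1) \/ ((G o t).+1 < steps (x o t) n.+1)))).
  move=> o t; rewrite /embed; case: asboolP => [h|h].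
    split=> [[[-> //]|[_ h']]|->]; last by left.
    by have [n nP] := h; have := h' n; rewrite -nP ltnn steps_ge => /(_ isT)[].
  split=> [[[_ /h //]|[-> //]]|->]; right; split => // n _.
  by have [lt|lt|eq] := ltngtP (steps (x o t) n.+1) (G o t).+1;
    [left|right|case: h; exists n].
have tFc H : rtot H -> rtot (fun o t => H o (cfst t)).
  by move=> tH; apply: (rtot_comp tH); rt.
have tGc := tFc _ tG.
have ts : rtot (fun o t => steps (x o (cfst t)) (csnd t).+1).
  apply: (rtot_steps (x := fun o t => x o (cfst t))); last by rt.
  by apply: rtot_app2; rt.
apply: sd_or; apply: sd_and.
- by apply: sd_eq; rt.
- by apply: sd_ex; apply: sd_eq; rt.
- by apply: sd_eq; rt.
- apply: sd_ball; first by rt.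
  by apply: sd_or; apply: sd_leq; rt.
Qed.

End Embedding.

(** * The compact image of a closed set and its kernel *)

Section FromBaire.
Variables (R : realType) (X : computableMetricSpace R).
Hypothesis polX : computable_polish X.
Variables (iota : (nat -> bool) -> X) (e : code).
Hypothesis iota_inj : injective iota.
Hypothesis iotaP : forall (u : nat -> bool) n, exists v,
  eval (fun k => u k) e n v /\ mdist (cms_seq X v) (iota u) <= 2 ^- n.
Local Notation alpha := (cms_seq X).
Local Notation B := (baire_cms R).
Implicit Types (p : baire) (x y : B) (u : nat -> bool) (K : set (nat -> bool)).

(** By the use principle the approximation of [iota u] depends on finitely many bits of [u]. *)
Lemma iota_continuous u n : exists L, forall u',
  (forall k, (k < L)%N -> u' k = u k) -> mdist (iota u) (iota u') < 2 ^- n.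
Proof.
have [v [uv vu]] := iotaP u n.+2; have [L ev] := eval_finite_use uv.
exists L => u' u'u; have [v' [u'v' vu']] := iotaP u' n.+2.
have ev' : eval (fun k => u' k) e n.+2 v.
  by apply: evalR_upto_eval ev => k /u'u ->.
move: vu'; rewrite (eval_functional u'v' ev') => vu'.
have := metric_triangle (iota u) (alpha v) (iota u').
rewrite [mdist (iota u) (alpha v)]metric_sym => ?.
have := pow2V_double R n; have := pow2V_double R n.+1.
by have := pow2V_gt0 R n.+2; move=> *; lra.
Qed.

(** The image of the closed set [K] is compact: points of [K] whose images approach [y] would
    cluster at a preimage of [y] in [K]. *)
Lemma iota_far K (y : X) :
  (forall u, ~ K u -> exists L, forall u',
     (forall k, (k < L)%N -> u' k = u k) -> ~ K u') ->
  (forall u, K u -> iota u <> y) ->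
  exists N, forall u, K u -> 2 ^- N <= mdist y (iota u).
Proof.
move=> clK Ky; apply: contrapT => h.
have /choice[v vP] : forall N, exists u, K u /\ mdist y (iota u) < 2 ^- N.
  move=> N; apply: contrapT => hN; apply: h; exists N => u Ku.
  by rewrite leNgt; apply/negP => lt; apply: hN; exists u.
have [u uP] := cantor_cluster v.
have Ku : K u.
  apply: contrapT => /clK[L LP]; have [N _ /LP] := uP L.
  by apply; have [] := vP N.
apply: (Ky u Ku); apply/esym/mdist_positivity/eqP; rewrite eq_le mdist_ge0 andbT.
apply/ler_addgt0Pl => d d0; rewrite addr0.
have [n nd] := pow2V_lt d0; have [L LP] := iota_continuous u n.+1.
have [N LN NP] := uP (maxn L n.+1).
have [_ vN] := vP N.
have : mdist (iota u) (iota (v N)) < 2 ^- n.+1.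
  by apply: LP => k kL; apply: NP; rewrite leq_max kL.
have : 2 ^- N <= 2 ^- n.+1 :> R.
  by rewrite pow2V_le; apply: leq_trans LN; exact: leq_maxr.
have := metric_triangle y (iota (v N)) (iota u).
rewrite [mdist (iota (v N)) _]metric_sym => ? ? ?.
by have := pow2V_double R n => ?; lra.
Qed.

Let j x : X := iota (embed x).

Lemma j_inj x y : j x = j y -> x = y.
Proof.
move=> /iota_inj xy; apply/funext => k.
by apply: (@embed_inj_prefix x y k.+1) => // i _; rewrite xy.
Qed.

Lemma j_continuous x n : exists L, forall y,
  (forall k, (k < L)%N -> (y : baire) k = (x : baire) k) ->
  mdist (j x) (j y) < 2 ^- n.
Proof.
have [L LP] := iota_continuous (embed x) n; exists L => y xy; apply: LP => k kL.
have xy' : forall k, (k < L)%N -> (x : baire) k = (y : baire) k.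
  by move=> i /xy ->.
rewrite (embed_prefix xy') //.
by apply: leq_trans kL _; exact: steps_ge.
Qed.

(** The open subset of Cantor space generated by the codes of finite sequences whose cylinders are
    formally included in an enumerated ball. On the range of [embed] it is the complement of the
    named set. *)
Definition excluded p (u : baire) : Prop := exists t n i,
  strict_in B t n (p i) /\
  forall k, (k < steps (baire_seq t) n)%N ->
    u k = nat_of_bool (embed (baire_seq t) k).

Lemma excluded_embed p x : excluded p (fun k => embed x k) <->
  (\bigcup_i basic_ball B (p i)) x.
Proof.
split=> [[t [n [i [ti tx]]]]|[i _]].
  exists i => //; apply: (strict_in_sub ti); apply/baire_dist_le => k kn.
  apply: (embed_inj_prefix (y := x)) kn => l /tx.
  by case: (embed x l); case: (embed _ l).
have /choice[s sP] n := baire_alpha_prefix x n.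
move=> /(@basic_ball_strict_in _ _ _ _ s)[k|n h].
  by apply/baire_dist_le => l lk; exact: sP.
exists (s n), n, i; split => // k kn; congr nat_of_bool; apply/esym.
by apply: embed_prefix kn; exact: sP.
Qed.

Lemma excluded_open p u : excluded p (fun k => u k) -> exists L, forall u',
  (forall k, (k < L)%N -> u' k = u k) -> excluded p (fun k => u' k).
Proof.
move=> [t [n [i [ti tu]]]]; exists (steps (baire_seq t) n) => u' u'u.
by exists t, n, i; split => // k kn; rewrite u'u // tu.
Qed.

Lemma sd_excluded : sd (fun o _ => excluded (evens o) (odds o)).
Proof.
do 3 apply: sd_ex; apply: sd_and; first by apply: sd_strict_in; rt.
apply: sd_ball.
  apply: (rtot_steps (x := fun o t => baire_seq (csnd (cfst (cfst t))))); rt.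
apply: (sd_eq_embed (x := fun o t =>
  baire_seq (csnd (cfst (cfst (cfst t)))))); rt.
Qed.

Definition image_set p : set X :=
  [set y | exists u, ~ excluded p (fun k => u k) /\ y = iota u].

Lemma image_set_j p x : image_set p (j x) ->
  (~` (\bigcup_i basic_ball B (p i))) x.
Proof.
by move=> [u [nex /iota_inj eu]] /excluded_embed; rewrite eu.
Qed.

Lemma j_image_set p x : (~` (\bigcup_i basic_ball B (p i))) x ->
  image_set p (j x).
Proof. by move=> Cx; exists (embed x); split => // /excluded_embed. Qed.

(** The oracle [s o] need only have a Sigma_1 graph, so [e] can be run on an embedded sequence. *)
Lemma sd_eval (s : baire -> baire) F G :
  sd (fun o t => csnd t = s o (cfst t)) -> rtot F -> rtot G ->
  sd (fun o t => eval (s o) e (F o t) (G o t)).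
Proof.
move=> ss tF tG; apply: (@sd_ext (fun o t =>
    evalR (fun i k => k = s o i) e (F o t) (G o t))).
  by move=> o t; exact: evalRE.
have h : sd (fun o t => evalR (fun i k => k = s o i) e (cfst (csnd t))
    (csnd (csnd t))).
  apply: (@sd_evalR (fun o _ i k => k = s o i)).
  by apply: sd_ext (sd_sub ss (rtot_snd rtot_id)).
have := sd_sub h (rtot_pair (rtot_const 0) (rtot_pair tF tG)).
by apply: sd_ext => o t; rewrite !(cfst_pair, csnd_pair).
Qed.

(** A small ball misses the image when every [u] is excluded or visibly mapped away from it;
    compactness keeps this quantifier over [u] Sigma_1. *)
Lemma image_set_name : exists phi, forall p, exists p',
  computes phi p p' /\ ~` (\bigcup_i basic_ball X (p' i)) = image_set p.
Proof.
(* The factor 2 covers the error of [v] and the radius of the ball around [alpha (cfst t)]. *)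
pose W o t := excluded (evens o) (odds o) \/ exists v,
  eval (odds o) e (csnd t) v /\
  2%:R * 2 ^- csnd t < mdist (alpha v) (alpha (cfst t)).
have sW : sd W.
  apply: sd_or; first exact: sd_excluded.
  apply: sd_ex; apply: sd_and.
    by apply: (sd_eval (s := odds)); first apply: sd_eq; rt.
  by apply: sd_dist_gt_pow2V; rt.
have [phi phiP] := sd_negative_name X (sd_cantor_forall sW).
exists phi => p; have [p' [p'c p'E]] := phiP p; exists p'; split => //.
rewrite p'E; apply/seteqP; split=> y /=; last first.
  move=> [u [nex yu]] [t [/(_ u) Wt yt]]; move: Wt.
  rewrite /W evens_interleave odds_interleave => -[//|[v [uv vc]]].
  have [v' [uv' vu]] := iotaP u (csnd t).
  rewrite (eval_functional uv' uv) -yu in vu.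
  have := metric_triangle (alpha v) y (alpha (cfst t)).
  by rewrite leNgt => /negP; apply; lra.
move=> ny; apply: contrapT => nA; apply: ny.
have [N NP] : exists N, forall u, ~ excluded p (fun k => u k) ->
    2 ^- N <= mdist y (iota u).
  apply: iota_far => [u /contrapT/excluded_open[L LP]|u nex uy].
    by exists L => u' /LP ? ?.
  by apply: nA; exists u.
(* The distance of at least [4 * 2 ^- N.+2] loses one unit at each end and still exceeds two
   units. *)
have [c cP] := dense_near y (pow2V_gt0 R N.+2).
exists (cpair c N.+2); rewrite !(cfst_pair, csnd_pair); split => // u.
rewrite /W evens_interleave odds_interleave !(cfst_pair, csnd_pair).
have [ex|/NP uN] := pselect (excluded p (fun k => u k)); first by left.
right; have [v [uv vu]] := iotaP u N.+2; exists v; split => //.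
have := metric_triangle y (alpha c) (iota u).
have := metric_triangle (alpha c) (alpha v) (iota u).
rewrite [mdist (alpha c) (alpha v)]metric_sym => ? ?.
have := pow2V_double R N; have := pow2V_double R N.+1; move=> *; lra.
Qed.

Lemma countable_exceptions (S : set B) : countable S ->
  countable [set y | (exists u, (exists k, forall i, (k <= i)%N -> u i = false)
                        /\ y = iota u) \/ exists x, S x /\ y = j x].
Proof.
move=> /(countable_enum ((fun=> 0%N) : B))[z zP].
have [w wP] := countable_enum (fun=> false) countable_finite_support.
apply: (@enum_countable _ _ (fun n =>
  if odd n then iota (w n./2) else j (z n./2))) => y [[u [ufin ->]]|[x [Sx ->]]].
  have [n ->] := wP u ufin; exists n.*2.+1.
  by rewrite /= odd_double /= uphalf_double.
have [n ->] := zP x Sx; exists n.*2.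
by rewrite odd_double doubleK.
Qed.

(** This provides a kernel of the image. What it omits comes from sequences with finitely many ones
    or from points outside [P], and there are countably many of either kind. *)
Lemma image_kernel p (P : set B) :
  closed (image_set p) ->
  perfect_kernel (~` (\bigcup_i basic_ball B (p i))) P ->
  perfect_kernel (image_set p) (closure (j @` P)).
Proof.
move=> clA [[clP limP] PC cnt].
have PA : closure (j @` P) `<=` image_set p.
  apply: subset_trans clA; apply: closureS => _ [x Px <-].
  exact/j_image_set/PC.
split=> //; last first.
  apply: sub_countable (countable_exceptions cnt); apply: subset_card_le.
  move=> y [[u [nex ->]] nQ]; have [fin|[x ux]] := embed_cases u.
    by left; exists u.
  right; exists x; split; last by rewrite ux.
  split; first by apply: image_set_j; exists u; split; rewrite ?/j -?ux.
  by move=> Px; apply: nQ; apply: subset_closure; exists x => //; rewrite ux.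
apply: perfect_setP; first exact: closed_closure.
move=> y cy U yU; have [_ [[x Px <-] Ux]] := cy _ yU.
have [xy|xy] := eqVneq (j x) y; last first.
  by exists (j x); split => //; apply: subset_closure; exists x.
(* If the nearby point is [y] itself, a second point of [P] close to [x] replaces it, as [j] is
   continuous and injective. *)
move: yU; rewrite -xy => /nbhs_ballP [d /= d0 dU].
have [n nd] := pow2V_lt d0; have [L LP] := j_continuous x n.
have : limit_point P x by rewrite limP.
move=> /(_ [set z | forall k, (k < L)%N -> (z : baire) k = (x : baire) k]).
case=> [|z [zx Pz /= zL]]; first by apply/baire_nbhsP; exists L.
exists (j z); split.
- by apply: contra zx => /eqP/j_inj ->.
- by apply: subset_closure; exists z.
- by apply: dU; rewrite ballEmdist /=; apply: lt_trans nd; exact: LP.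
Qed.

(** If only one side held, a neighbourhood of a point of a perfect set would meet that set in
    countably many points. One direction transports points by the injective continuous [j], the
    other uses compactness to control the points near [j x]. *)
Lemma kernel_preimage p (P : set B) (Q : set X) x :
  perfect_kernel (~` (\bigcup_i basic_ball B (p i))) P ->
  perfect_kernel (image_set p) Q -> P x <-> Q (j x).
Proof.
move=> [perfP PC cntP] [perfQ QA cntQ]; split=> [Px|Qx]; apply: contrapT => nK.
  have [clQ _] := perfQ; have [N NP] := closed_dist clQ nK.
  have [L LP] := j_continuous x N.
  apply: (perfect_not_countable (baire_polish (R := R)) perfP Px (pow2V_gt0 R L)).
  move/countable_injP: cntQ => [f finj]; apply/countable_injP.
  have sub y : (P `&` [set y | mdist x y < 2 ^- L]) y ->
      (image_set p `\` Q) (j y).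
    move=> [Py /baire_mdist_lt xy]; split; first exact/j_image_set/PC.
    move=> /NP; rewrite leNgt => /negP; apply; apply: LP => k kL.
    by rewrite xy // ltnW.
  exists (f \o j) => y z /set_mem /sub Ay /set_mem /sub Az /= /finj.
  by rewrite !inE => /(_ Ay Az) /j_inj.
have [clP _] := perfP; have [N NP] := closed_dist clP nK.
have near_x y : (forall k, (k < N.+1)%N -> (x : baire) k = (y : baire) k) -> ~ P y.
  by move=> xy /NP; rewrite leNgt => /negP; apply; apply/baire_mdist_lt.
(* The image of [K] stays away from [j x]. Hence points of the image near [j x] come from sequences
   starting with the code of [x] up to [N.+1], and there [P] has no points. *)
pose K u := ~ excluded p (fun k => u k) /\
  ~ forall k, (k < steps x N.+1)%N -> u k = embed x k.
have [M MP] : exists M, forall u, K u -> 2 ^- M <= mdist (j x) (iota u).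
  apply: iota_far => [u nK'|u [_ nu] /iota_inj eu]; last first.
    by apply: nu; rewrite eu.
  have [/excluded_open[L LP]|nex] := pselect (excluded p (fun k => u k)).
    by exists L => u' /LP ? -[].
  exists (steps x N.+1) => u' u'u [_ nu']; apply: nu' => k kx.
  rewrite u'u //; move: k kx {u'u}; apply: contrapT => nu; exact: nK'.
apply: (perfect_not_countable polX perfQ Qx (pow2V_gt0 R M)).
apply: sub_countable (countable_exceptions cntP); apply: subset_card_le.
move=> y [/QA[u [nex ->]] /= uM].
have ux : forall k, (k < steps x N.+1)%N -> u k = embed x k.
  by apply: contrapT => nu; have := MP u (conj nex nu); rewrite leNgt uM.
have [fin|[z uz]] := embed_cases u; first by left; exists u.
right; exists z; split; last by rewrite uz.
split; first by apply: image_set_j; exists u; split; rewrite ?/j -?uz.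
by apply: near_x; apply: embed_inj_prefix; rewrite -uz.
Qed.

Lemma baire_le_PK : weihrauch_le (PK B) (PK X).
Proof.
have [phi phiP] := image_set_name.
(* The oracle interleaves [interleave p q] with the point, so [odds (evens o)] is the name [q] of
   the kernel in [X] and [odds o] is the point of Baire space. *)
pose W o (t : nat) := exists i n v, eval (fun k => embed (odds o) k) e n v /\
  strict_in X v n (odds (evens o) i).
have sW : sd W.
  do 3 apply: sd_ex; apply: sd_and.
    apply: (sd_eval (s := fun o k => embed (odds o) k)); try by rt.
    by apply: (sd_eq_embed (x := fun o _ => odds o)); rt.
  by apply: sd_strict_in; rewrite ?/odds; rt.
have [psi psiP] := sd_baire_name R sW.
exists phi, psi => A p [[P clP] PA] pA.
have [p' [p'c p'E]] := phiP p.
have clA : closed (image_set p) by rewrite -p'E; exact: closed_name.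
have kP : perfect_kernel (~` (\bigcup_i basic_ball B (p i))) P.
  by rewrite -pA; exact: PA.
exists p', (exist _ (image_set p) clA); split => //.
  by exists (exist _ _ (@closed_closure _ (j @` P))); exact: image_kernel.
move=> [Q clQ] q QA qQ.
have kQ : perfect_kernel (image_set p) Q := QA.
have {}qQ : Q = ~` (\bigcup_i basic_ball X (q i)) := qQ.
have [q' [q'c q'E]] := psiP (interleave p q).
exists q', (exist _ P clP); split => //.
rewrite /= /negative_name q'E /=; apply/seteqP; split=> x /=.
all: rewrite /W evens_interleave !odds_interleave (kernel_preimage x kP kQ) qQ.
  move=> nx [i [n [v [ev vn]]]]; apply: nx; exists i => //.
  have [v' [ev' vx]] := iotaP (embed x) n.
  rewrite (eval_functional ev' ev) in vx.
  exact: strict_in_sub vn vx.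
move=> nW [i _]; have /choice[r rP] := iotaP (embed x).
move=> /(@basic_ball_strict_in _ _ _ _ r)[k|n rn].
  by have [] := rP k.
by apply: nW; exists i, n, (r n); split => //; have [] := rP n.
Qed.

End FromBaire.

Theorem theorem5p18 (R : realType) (X : computableMetricSpace R)
  (polishX : computable_polish X) (richX : rich X) :
  weihrauch_equiv (PK X) (PK (baire_cms R)).
Proof.
split; first exact: PK_le_baire.
have [iota [iota_inj [e eP] _]] := richX.
apply: (@baire_le_PK _ _ polishX iota e) => // u n.
have [|q [y [qe qy yE]]] := eP u (fun k => u k) _ erefl; first by exists (iota u).
exists (q n); split; first exact: qe.
by rewrite -[iota u]yE; exact: cauchy_name_dist.
Qed.
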